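(* Let $H=T+V$ be as in the context. There exists $C<\infty$, depending only on $C_V$, such that \[\mathbb{E}\,\Big|\frac{1}{2N}\frac{\partial^2}{\partial z^2}G(x,y;z)\Big|\le\frac{C}{N(\operatorname{Im}z)^2}\] and \[\mathbb{E}\,\Big|S(z)\frac{\partial}{\partial z}G(x,y;z)\Big|\le CN\Big(\log N+\frac{1}{N\operatorname{Im}z}\Big)\Big(1+\frac{1}{(N\operatorname{Im}z)^2}\Big)+\frac{C}{\operatorname{Im}z}\] for all $x,y\in\{1,\dots,N\}$ and all $z$ with $\operatorname{Im}z>0$.
   Context: $H=T+V$ is an $N\times N$ random matrix, where $V=\sum_x V(x)|\delta_x\rangle\langle\delta_x|$ is a random diagonal potential with $\mathbb{P}(V(x)\in I\mid\{V(y)\}_{y\ne x})\le C_V|I|$ for all Borel $I\subset\mathbb{R}$ and all $x$, and $T$ is a Hermitian random matrix independent of $V$. $G(x,y;z)=\langle\delta_y,(H-z)^{-1}\delta_x\rangle$ and $S(z)=\frac1N\operatorname{Tr}(H-z)^{-1}$. *)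

(* Defs.v *)
From HB Require Import structures.
From mathcomp Require Import all_boot all_order all_algebra.
From mathcomp Require Import all_classical all_reals all_analysis.
From mathcomp.real_closed Require Export complex.
Export Order.TTheory GRing.Theory Num.Theory.
Export numFieldNormedType.Exports.

Set Implicit Arguments.
Unset Strict Implicit.
Unset Printing Implicit Defensive.

Local Open Scope ring_scope.
Local Open Scope classical_set_scope.

Section Defs.
Variable R : realType.

Definition hermitian_mx (n : nat) (A : 'M[R[i]]_n) : Prop :=
  map_mx (@conjc R) A^T = A.

Definition hamiltonian (n : nat) (T : 'M[R[i]]_n) (V : 'I_n -> R) : 'M[R[i]]_n :=
  T + diag_mx (\row_i ((V i)%:C)%C).

(* Green function G(x,y;z) = <delta_y, (H - z)^{-1} delta_x> = ((H - z)^{-1})_{y x}. *)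
Definition green (n : nat) (H : 'M[R[i]]_n) (x y : 'I_n) (z : R[i]) : R[i] :=
  (invmx (H - z%:M)) y x.

Definition stieltjes (n : nat) (H : 'M[R[i]]_n) (z : R[i]) : R[i] :=
  (n%:R)^-1 * \tr (invmx (H - z%:M)).

Definition cderiv (f : R[i] -> R[i]) : R[i] -> R[i] :=
  @derive1 R[i] (R[i])^o f.

Definition cabs (w : R[i]) : R := complex.Re `|w|.

Definition gen_sigma d (Omega : measurableType d) (I : Type) (P : I -> Prop)
    (f : I -> Omega -> R) : set (set Omega) :=
  <<s [set A | exists i (B : set R), [/\ P i, measurable B & A = f i @^-1` B]] >>.

(* sigma(T): generated by the real and imaginary parts of all entries of T. *)
Definition entry_rv (n : nat) d (Omega : measurableType d) (T : Omega -> 'M[R[i]]_n)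
    (ijb : 'I_n * 'I_n * bool) : Omega -> R :=
  fun w => if ijb.2 then complex.Re (T w ijb.1.1 ijb.1.2) else complex.Im (T w ijb.1.1 ijb.1.2).

End Defs.

(* Main.v *)
(** Write R = (H - z)^-1, eta = Im z. Derivatives of G are entries of powers of R, and the
    Ward identity sum_k |R(k,x)|^2 = Im R(x,x) / eta bounds |R^2(y,x)| and eta |R^3(y,x)| by
    (Im R(x,x) + Im R(y,y)) / (2 eta).  As a function of V(x) alone, R(x,x) = 1 / (V(x) - w) with
    Im w >= eta and w independent of V(x); hence Im R(x,x) is a Poisson kernel in V(x) and averaging
    over V(x) costs only a constant times the density bound, even against a weight depending on the
    other sites.  For the second bound, the rank-one change V(x) := 0 moves tr R by at most 1 / eta,
    so |S(z)| is dominated by such a weight, built from |R(u,u)| with u <> x; and |1 / (s - w)| is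
    at most 1 plus O(log (1 / eta)) Poisson kernels at dyadic scales. *)
Require Import Defs.
From HB Require Import structures.
From mathcomp Require Import all_boot all_order all_algebra.
From mathcomp Require Import all_classical all_reals all_analysis.
From mathcomp.real_closed Require Import complex.
From mathcomp Require Import measurable_realfun ring lra.
Import Order.TTheory GRing.Theory Num.Theory.
Import numFieldNormedType.Exports.
Set Implicit Arguments.
Unset Strict Implicit.
Unset Printing Implicit Defensive.
Local Open Scope ring_scope.
Local Open Scope classical_set_scope.

(** * Resolvents of Hermitian matrices *)

(** The hypothesis on [V] only bounds the probability of {V(x) in I} intersected with an event of
    the other sites; no conditional density is at hand. The Poisson kernel is therefore averaged by
    a Riemann sum: V(x) is sorted into annuli of width [Im z], on each of which the kernel varies by
    a bounded factor because its own width is at least [Im z]. Two averages follow one another in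
    the second bound. Once V(x) has been integrated out against the weight, V(x) stays frozen at 0
    while each |R(u,u)| is averaged over its own V(u); the one-site estimates are therefore stated
    for modified potentials. The logarithm in the result comes from log (1 / Im z) = log N + log (1
    / (N Im z)), whose last term is at most 1 / (N Im z). All of this is done for a constant T;
    independence enters once, at the end, through Tonelli. *)

Section cabs.
Variable R : realType.
Implicit Types z w : R[i].

Lemma cabsE w : cabs w = Num.sqrt (complex.Re w ^+ 2 + complex.Im w ^+ 2).
Proof. by rewrite /cabs normc_def. Qed.

Lemma normr_cabs w : `|w| = (cabs w)%:C%C.
Proof. by rewrite cabsE normc_def. Qed.

Lemma cabs_ge0 w : 0 <= cabs w.
Proof. by rewrite cabsE sqrtr_ge0. Qed.

Lemma sqr_cabs w : cabs w ^+ 2 = complex.Re w ^+ 2 + complex.Im w ^+ 2.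
Proof. by rewrite cabsE sqr_sqrtr // addr_ge0 // sqr_ge0. Qed.

Lemma real_complexD (a b : R) : (a + b)%:C%C = a%:C%C + b%:C%C.
Proof. exact: rmorphD. Qed.

Lemma real_complexM (a b : R) : (a * b)%:C%C = a%:C%C * b%:C%C.
Proof. exact: rmorphM. Qed.

Lemma real_complex_le (a b : R) : (a%:C%C <= b%:C%C :> R[i]) = (a <= b).
Proof. exact: lecR. Qed.

Lemma real_complex_sum (I : Type) (r : seq I) (P : pred I) (F : I -> R) :
  (\sum_(i <- r | P i) F i)%:C%C = \sum_(i <- r | P i) (F i)%:C%C.
Proof. exact: rmorph_sum. Qed.

Lemma cabsM z w : cabs (z * w) = cabs z * cabs w.
Proof. by apply: complexI; rewrite -normr_cabs normrM !normr_cabs real_complexM. Qed.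

Lemma cabsN z : cabs (- z) = cabs z.
Proof. by rewrite /cabs normrN. Qed.

Lemma cabsV z : cabs z^-1 = (cabs z)^-1.
Proof. by apply: complexI; rewrite -normr_cabs normfV normr_cabs fmorphV. Qed.

Lemma cabsD z w : cabs (z + w) <= cabs z + cabs w.
Proof. by rewrite -real_complex_le real_complexD -!normr_cabs ler_normD. Qed.

Lemma cabs_sum (I : Type) (r : seq I) (P : pred I) (F : I -> R[i]) :
  cabs (\sum_(i <- r | P i) F i) <= \sum_(i <- r | P i) cabs (F i).
Proof.
by rewrite -real_complex_le real_complex_sum -normr_cabs (le_trans (ler_norm_sum _ _ _)).
Qed.

Lemma cabs_nat k : cabs (k%:R : R[i]) = k%:R.
Proof. by rewrite /cabs normr_nat -(rmorph_nat (real_complex R)). Qed.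

Lemma cabs_real (s : R) : cabs s%:C%C = `|s|.
Proof. by rewrite cabsE /= expr0n addr0 sqrtr_sqr. Qed.

Lemma cabs_conj z : cabs (conjc z) = cabs z.
Proof. by rewrite /cabs normcJ. Qed.

Lemma cabs_eq0 z : (cabs z == 0) = (z == 0).
Proof. by rewrite -(inj_eq (@complexI _)) -normr_cabs normr_eq0. Qed.

Lemma Im_le_cabs z : `|complex.Im z| <= cabs z.
Proof.
rewrite cabsE -sqrtr_sqr ler_sqrt ?sqr_ge0 //; last by rewrite addr_ge0 ?sqr_ge0.
by rewrite lerDr sqr_ge0.
Qed.

Lemma Re_subc z w : complex.Re (z - w) = complex.Re z - complex.Re w.
Proof. by case: z; case: w. Qed.
Lemma Im_subc z w : complex.Im (z - w) = complex.Im z - complex.Im w.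
Proof. by case: z; case: w. Qed.
Lemma Im_addc z w : complex.Im (z + w) = complex.Im z + complex.Im w.
Proof. by case: z; case: w. Qed.
Lemma Re_addc z w : complex.Re (z + w) = complex.Re z + complex.Re w.
Proof. by case: z; case: w. Qed.
Lemma Re_mulc z w : complex.Re (z * w) = complex.Re z * complex.Re w - complex.Im z * complex.Im w.
Proof. by case: z; case: w. Qed.
Lemma Im_mulc z w : complex.Im (z * w) = complex.Re z * complex.Im w + complex.Im z * complex.Re w.
Proof. by case: z => a b; case: w => c d /=. Qed.

End cabs.

Section resolvent.
Variable R : realType.
Local Notation Im := complex.Im.
Local Notation Re := complex.Re.

Definition resolvent n (H : 'M[R[i]]_n) (z : R[i]) : 'M[R[i]]_n :=
  invmx (H - z%:M).

Definition norm2 n (v : 'cV[R[i]]_n) : R := \sum_i cabs (v i 0) ^+ 2.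

Lemma norm2_eq0 n (v : 'cV[R[i]]_n) : norm2 v = 0 -> v = 0.
Proof.
move=> v0; apply/matrixP => i j; rewrite (ord1 j) mxE; apply/eqP.
rewrite -cabs_eq0 -sqrf_eq0; apply: contra_eqT v0 => vi0.
rewrite /norm2 (bigD1 i) //= gt_eqF // ltr_pwDl ?lt0r ?vi0 ?sqr_ge0 //.
by apply: sumr_ge0 => k _; exact: sqr_ge0.
Qed.

Lemma hermitian_tr n (H : 'M[R[i]]_n) : hermitian_mx H -> hermitian_mx H^T.
Proof. by rewrite /hermitian_mx => HH; rewrite -{2}HH map_trmx !trmxK. Qed.

Definition hdot n (u v : 'cV[R[i]]_n) : R[i] := \sum_i conjc (u i 0) * v i 0.

Lemma Im_hdot_hermitian n (H : 'M[R[i]]_n) (v : 'cV[R[i]]_n) :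
  hermitian_mx H -> Im (hdot v (H *m v)) = 0.
Proof.
move=> HH; have : conjc (hdot v (H *m v)) = hdot v (H *m v).
  rewrite /hdot rmorph_sum /=.
  under eq_bigr => i _.
    rewrite rmorphM /= conjcK mxE rmorph_sum /= mulr_sumr.
    under eq_bigr do rewrite rmorphM /=.
    over.
  rewrite exchange_big /=; apply: eq_bigr => j _; rewrite mxE mulr_sumr.
  apply: eq_bigr => i _; rewrite -[in RHS]HH !mxE; ring.
case: (hdot _ _) => a b /= [] ?; lra.
Qed.

Lemma hdotxx n (v : 'cV[R[i]]_n) : hdot v v = (norm2 v)%:C%C.
Proof.
rewrite /norm2 real_complex_sum; apply: eq_bigr => i _.
by rewrite expr2 real_complexM -normr_cabs -expr2 sqr_normc mulrC.
Qed.

(* <v, H v> is real, so the imaginary part of <v, (H - z) v> only sees z. *)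
Lemma Im_hdot_shift n (H : 'M[R[i]]_n) (z : R[i]) (v : 'cV[R[i]]_n) :
  hermitian_mx H -> Im (hdot v ((H - z%:M) *m v)) = - (Im z * norm2 v).
Proof.
move=> HH.
have -> : hdot v ((H - z%:M) *m v) = hdot v (H *m v) - z * hdot v v.
  rewrite /hdot mulr_sumr -sumrB; apply: eq_bigr => i _.
  by rewrite mulmxBl mul_scalar_mx !mxE; ring.
by rewrite Im_subc Im_hdot_hermitian // hdotxx Im_mulc /= mulr0 !add0r.
Qed.

(** A kernel vector v would give <v, (H - z) v> = 0, whose imaginary part is - Im z |v|^2. [det0P]
    supplies a left kernel vector, hence the passage to the transpose. *)
Lemma shift_unitmx n (H : 'M[R[i]]_n) (z : R[i]) :
  hermitian_mx H -> 0 < Im z -> H - z%:M \in unitmx.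
Proof.
move=> HH z0; rewrite -unitmx_tr unitmxE unitfE; apply/negP => /det0P[v v0 Av].
have Av' : (H - z%:M) *m v^T = 0 by rewrite -[LHS]trmxK trmx_mul trmxK Av trmx0.
have := Im_hdot_shift z v^T HH; rewrite Av' /hdot.
under eq_bigr do rewrite [X in _ * X]mxE mulr0.
rewrite big1 //= => /eqP; rewrite eq_sym oppr_eq0 mulf_eq0 gt_eqF //= => /eqP /norm2_eq0.
by move=> /(congr1 trmx); rewrite trmxK trmx0 => /eqP; apply/negP.
Qed.

Section ward_identity.
Variables (n : nat) (H : 'M[R[i]]_n) (z : R[i]).
Hypotheses (HH : hermitian_mx H) (z0 : 0 < Im z).
Local Notation G := (resolvent H z).

(** [Im_hdot_shift] at v = G b, where (H - z) v = b. Taking b to be a basis vector yields the Ward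
    identity. *)
Lemma Im_hdot_resolvent (b : 'cV[R[i]]_n) : Im (hdot b (G *m b)) = Im z * norm2 (G *m b).
Proof.
have := Im_hdot_shift z (G *m b) HH.
rewrite mulmxA mulmxV ?shift_unitmx // mul1mx.
have -> : hdot (G *m b) b = conjc (hdot b (G *m b)).
  rewrite /hdot rmorph_sum; apply: eq_bigr => i _.
  by rewrite rmorphM /= conjcK mulrC.
by case: (hdot _ _) => ? ? /= /oppr_inj.
Qed.

(** The operator norm bound 1 / Im z, squared. It follows from the previous identity and AM-GM,
    without the spectral theorem. *)
Lemma norm2_resolvent_le (b : 'cV[R[i]]_n) : norm2 (G *m b) <= norm2 b / Im z ^+ 2.
Proof.
have h : Im z * norm2 (G *m b) <= \sum_i cabs (b i 0) * cabs ((G *m b) i 0).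
  rewrite -Im_hdot_resolvent (le_trans (ler_norm _)) // (le_trans (Im_le_cabs _)) //.
  rewrite (le_trans (cabs_sum _ _ _)) //; apply: ler_sum => i _.
  by rewrite cabsM cabs_conj.
have h2 : \sum_i cabs (b i 0) * cabs ((G *m b) i 0) <=
   2^-1 * (norm2 b / Im z + Im z * norm2 (G *m b)).
  rewrite /norm2 mulr_suml mulr_sumr -big_split mulr_sumr; apply: ler_sum => i _ /=.
  set p := cabs _; set q := cabs _.
  rewrite -subr_ge0.
  have -> : 2^-1 * (p ^+ 2 / Im z + Im z * q ^+ 2) - p * q =
     (p - Im z * q) ^+ 2 / (2 * Im z) by field; rewrite gt_eqF.
  by rewrite mulr_ge0 ?sqr_ge0 // invr_ge0 mulr_ge0 // ltW.
rewrite ler_pdivlMr ?exprn_gt0 //.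
have : Im z * norm2 (G *m b) <= norm2 b / Im z by lra.
by rewrite ler_pdivlMr // expr2; lra.
Qed.

Lemma resolvent_tr : resolvent H^T z = G^T.
Proof. by rewrite /resolvent trmx_inv linearB /= tr_scalar_mx. Qed.

Lemma mulmx_delta_col m p (A : 'M[R[i]]_(m, p)) i x : (A *m delta_mx x 0 :> 'cV_m) i 0 = A i x.
Proof. by rewrite -colE mxE. Qed.

Lemma hdot_delta x (v : 'cV[R[i]]_n) : hdot (delta_mx x 0) v = v x 0.
Proof.
rewrite /hdot (bigD1 x) //= mxE !eqxx conjc1 mul1r big1 ?addr0 // => i ix.
by rewrite mxE (negPf ix) rmorph0 mul0r.
Qed.

Lemma ward_col x : Im (G x x) = Im z * \sum_k cabs (G k x) ^+ 2.
Proof.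
have := Im_hdot_resolvent (delta_mx x 0).
rewrite hdot_delta mulmx_delta_col => ->; congr (_ * _).
by apply: eq_bigr => k _; rewrite mulmx_delta_col.
Qed.

End ward_identity.

Section resolvent_bounds.
Variables (n : nat) (H : 'M[R[i]]_n) (z : R[i]).
Hypotheses (HH : hermitian_mx H) (z0 : 0 < Im z).
Local Notation G := (resolvent H z).

(** The transpose of H is again Hermitian, with resolvent the transpose of G, so the column identity
    transfers to rows. *)
Lemma ward_row x : Im (G x x) = Im z * \sum_k cabs (G x k) ^+ 2.
Proof.
have := ward_col (hermitian_tr HH) z0 x.
rewrite resolvent_tr mxE => ->; congr (_ * _).
by apply: eq_bigr => k _; rewrite mxE.
Qed.

Lemma Im_resolvent_ge0 x : 0 <= Im (G x x).
Proof. by rewrite ward_row mulr_ge0 ?sumr_ge0 ?(ltW z0) // => i _; exact: sqr_ge0. Qed.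

Lemma sqr_resolvent_le x : Im z * cabs (G x x) ^+ 2 <= Im (G x x).
Proof.
rewrite ward_row (ler_pM2l z0) (bigD1 x) //= lerDl.
by apply: sumr_ge0 => i _; exact: sqr_ge0.
Qed.

Lemma cabs_resolvent_le x : cabs (G x x) <= (Im z)^-1.
Proof.
have h1 := sqr_resolvent_le x; have h2 := le_trans (ler_norm _) (Im_le_cabs (G x x)).
have [->|g0] := eqVneq (cabs (G x x)) 0; first by rewrite invr_ge0 ltW.
have {}g0 : 0 < cabs (G x x) by rewrite lt0r g0 cabs_ge0.
rewrite -(ler_pM2l z0) divff ?gt_eqF // -(ler_pM2r g0) mul1r -mulrA -expr2.
exact: le_trans h2.
Qed.

(** If the imaginary part vanished, the Ward identity would kill the whole column of an invertible
    matrix. Strictness is what allows division by G(x,x) and by 1 + s G(x,x). *)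
Lemma resolvent_gt0 x : 0 < Im (G x x).
Proof.
have unit := shift_unitmx HH z0.
rewrite lt0r Im_resolvent_ge0 andbT; apply/eqP => G0.
have := Im_hdot_resolvent HH z0 (delta_mx x 0).
rewrite hdot_delta mulmx_delta_col G0 => /esym/eqP.
rewrite mulf_eq0 gt_eqF //= => /eqP/norm2_eq0 /(congr1 (mulmx (H - z%:M))).
rewrite mulmxA mulmxV // mul1mx mulmx0 => /matrixP /(_ x 0).
by rewrite !mxE !eqxx => /eqP; rewrite oner_eq0.
Qed.

(** Cauchy-Schwarz in AM-GM form: the result is a sum, whose expectation can be taken term by term.
    The weight [t] balances two factors of different size. *)
Lemma cabs_sum_mul_le (I : finType) (t : R) (u v : I -> R[i]) : 0 < t ->
  cabs (\sum_k u k * v k) <=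
  2^-1 * (t^-1 * (\sum_k cabs (u k) ^+ 2) + t * \sum_k cabs (v k) ^+ 2).
Proof.
move=> t0; rewrite (le_trans (cabs_sum _ _ _)) // !mulr_sumr -big_split mulr_sumr.
apply: ler_sum => i _ /=; rewrite cabsM -subr_ge0.
set p := cabs _; set q := cabs _.
have -> : 2^-1 * (t^-1 * p ^+ 2 + t * q ^+ 2) - p * q =
     (p - t * q) ^+ 2 / (2 * t) by field; rewrite gt_eqF.
by rewrite mulr_ge0 ?sqr_ge0 // invr_ge0 mulr_ge0 // ltW.
Qed.

Lemma resolvent2_le x y :
  cabs ((G *m G) y x) <= (Im (G x x) + Im (G y y)) / (2 * Im z).
Proof.
rewrite mxE (le_trans (cabs_sum_mul_le _ _ ltr01)) //.
by rewrite ward_col // [Im (G y y)]ward_row le_eqVlt; apply/orP; left; apply/eqP; field; rewrite gt_eqF.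
Qed.

(** Row y of G is paired with column x of G^2. The latter has norm at most 1 / Im z times that of
    column x of G, so the balancing weight is t = Im z. *)
Lemma resolvent3_le x y :
  cabs ((G *m G *m G) y x) <= (Im (G x x) + Im (G y y)) / (2 * Im z ^+ 2).
Proof.
rewrite -mulmxA mxE (le_trans (cabs_sum_mul_le _ _ z0)) //.
have := norm2_resolvent_le HH z0 (G *m delta_mx x 0).
have -> : norm2 (G *m delta_mx x 0) = \sum_k cabs (G k x) ^+ 2.
  by apply: eq_bigr => k _; rewrite mulmx_delta_col.
have -> : norm2 (G *m (G *m delta_mx x 0)) = \sum_k cabs ((G *m G) k x) ^+ 2.
  by apply: eq_bigr => k _; rewrite mulmxA mulmx_delta_col.
rewrite ward_col // [Im (G y y)]ward_row; set A := \sum_k _; set B := \sum_k _; set D := \sum_k _.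
rewrite ler_pdivlMr ?exprn_gt0 // => h.
have -> : (Im z * B + Im z * D) / (2 * Im z ^+ 2) = 2^-1 * ((Im z)^-1 * D + Im z * (B / Im z ^+ 2)).
  by field; rewrite gt_eqF.
apply: ler_pM => //; first by rewrite addr_ge0 // mulr_ge0 ?invr_ge0 ?(ltW z0) // sumr_ge0 // => i _; exact: sqr_ge0.
by rewrite lerD // ler_pM2l // ler_pdivlMr // exprn_gt0.
Qed.

End resolvent_bounds.

(** * Rank-one perturbations of the resolvent *)

Lemma resolvent_identity n (A B : 'M[R[i]]_n) : A \in unitmx -> B \in unitmx ->
  invmx A - invmx B = invmx A *m (B - A) *m invmx B.
Proof.
move=> uA uB.
by rewrite mulmxBr mulVmx // mulmxBl mul1mx -mulmxA mulmxV // mulmx1.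
Qed.

Section rank_one.
Variables (n : nat) (H : 'M[R[i]]_n) (z : R[i]) (x : 'I_n) (s : R).
Hypotheses (HH : hermitian_mx H) (z0 : 0 < Im z).
Let H' := H + s%:C%C *: delta_mx x x.
Hypothesis HH' : hermitian_mx H'.
Let G := resolvent H z.
Let G' := resolvent H' z.

Lemma rank_one_entry i j : G' i j = G i j - s%:C%C * G i x * G' x j.
Proof.
have E : G' - G = - (s%:C%C *: (G *m delta_mx x x *m G')).
  rewrite -opprB resolvent_identity ?shift_unitmx //.
  rewrite opprB addrA subrK /H' addrC addKr.
  by rewrite -scalemxAr -scalemxAl.
have /matrixP/(_ i j) := E; rewrite !mxE => /(canRL (subrK _)) ->.
rewrite addrC; congr (_ - _); rewrite -mulrA; congr (_ * _).
rewrite (bigD1 x) //= big1 ?addr0 => [|k kx]; last first.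
  rewrite mxE big1 ?mul0r // => l _; rewrite mxE (negPf kx) andbF mulr0 //.
rewrite mxE (bigD1 x) //= big1 ?addr0 => [|k kx]; last first.
  by rewrite mxE (negPf kx) /= mulr0.
by rewrite mxE !eqxx mulr1.
Qed.

Let g := G x x.

(** Its imaginary part is s Im g with Im g > 0, so a zero would force s = 0 and then 1 = 0. *)
Lemma rank_one_den_neq0 : 1 + s%:C%C * g != 0.
Proof.
apply/eqP => E; have /(congr1 (@complex.Im R)) := E.
rewrite Im_addc Im_mulc /= mul0r addr0 add0r => /eqP.
rewrite mulf_eq0 (gt_eqF (resolvent_gt0 HH z0 x)) orbF => /eqP s0.
by move: E; rewrite s0 mul0r addr0 => /eqP; rewrite oner_eq0.
Qed.

Lemma rank_one_row j : G' x j = G x j / (1 + s%:C%C * g).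
Proof.
apply: (canRL (mulfK rank_one_den_neq0)).
by rewrite mulrDr mulr1 {1}rank_one_entry -/g; ring.
Qed.

Lemma rank_one_diag : G' x x = (s%:C%C - (- g^-1))^-1.
Proof.
have g0 : g != 0.
  by apply/eqP => g0; have := resolvent_gt0 HH z0 x; rewrite -/G -/g g0 ltxx.
rewrite rank_one_row -/g.
have -> : s%:C%C - (- g^-1) = (1 + s%:C%C * g) / g.
  by rewrite mulrDl mul1r mulfK // opprK addrC.
by rewrite invf_div.
Qed.

(** The difference is - s G^2(x,x) / (1 + s g). Here |G^2(x,x)| is at most Im g / Im z and |1 + s g|
    is at least |s| Im g, so s cancels and the bound is uniform in it. *)
Lemma rank_one_trace_le : cabs (\tr G' - \tr G) <= (Im z)^-1.
Proof.
have -> : \tr G' - \tr G = - (s%:C%C * (G *m G) x x / (1 + s%:C%C * g)).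
  rewrite /mxtrace -sumrB mxE mulr_sumr mulr_suml -sumrN; apply: eq_bigr => i _.
  by rewrite rank_one_entry rank_one_row; ring.
rewrite cabsN !cabsM cabsV cabs_real.
have d0 : 0 < cabs (1 + s%:C%C * g).
  by rewrite lt0r cabs_ge0 cabs_eq0 rank_one_den_neq0.
rewrite ler_pdivrMr //.
have := resolvent2_le HH z0 x x; rewrite -/G -/g.
have -> : (Im g + Im g) / (2 * Im z) = Im g / Im z by field; rewrite gt_eqF.
move=> h; apply: le_trans (ler_wpM2l (normr_ge0 s) h) _.
rewrite mulrA mulrC ler_pM2l ?invr_gt0 //.
apply: le_trans (Im_le_cabs _).
by rewrite Im_addc Im_mulc /= add0r mul0r addr0 normrM (ger0_norm (Im_resolvent_ge0 HH z0 x)).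
Qed.

End rank_one.

(** Im (- 1 / g) = Im g / |g|^2, and the Ward identity bounds |g|^2 by Im g / Im z. This is what
    makes every later kernel at least as wide as the grid step [Im z]. *)
Lemma Im_inv_le n (H : 'M[R[i]]_n) (z : R[i]) (x : 'I_n) :
  hermitian_mx H -> 0 < Im z -> Im z <= Im (- (resolvent H z x x)^-1).
Proof.
move=> HH z0; have h := sqr_resolvent_le HH z0 x.
have g0 := resolvent_gt0 HH z0 x; move: h g0.
case: (resolvent H z x x) => a b; rewrite sqr_cabs /= => h b0.
have p : 0 < a ^+ 2 + b ^+ 2 by rewrite ltr_wpDl ?sqr_ge0 ?exprn_gt0.
by rewrite opprK ler_pdivlMr.
Qed.

Lemma Im_invB (s : R) (w : R[i]) :
  Im (s%:C%C - w)^-1 = Im w / ((s - Re w) ^+ 2 + Im w ^+ 2).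
Proof. by case: w => a b /=; rewrite sub0r mulNr opprK sqrrN. Qed.

End resolvent.

(** * Derivatives of the Green function *)

Lemma is_derive_quotient (K : numFieldType) (f : K^o -> K^o) (z l : K) :
  (forall e : K, 0 < e -> exists2 d : K, 0 < d & forall h : K, h != 0 -> `|h| < d ->
     `|l - h^-1 * (f (h + z) - f z)| <= e) ->
  is_derive (z : K^o) (1 : K^o) f l.
Proof.
move=> H.
have h : (fun h : K => h^-1 *: ((f \o shift (z : K^o)) (h *: (1 : K^o)) - f z)) @ (0 : K)^' -->
    (l : K^o).
  apply/cvgrPdist_le => /= e /H[d d0 Hd].
  near=> h; rewrite [h *: 1]mulr1; apply: Hd.
    by near: h; exact: nbhs_dnbhs_neq.
  by near: h; exact: dnbhs0_lt.
apply: DeriveDef; first by apply/cvg_ex; exists l; exact: h.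
exact: cvg_lim h.
Unshelve. all: by end_near.
Qed.

Lemma is_derive_derive1 (K : numFieldType) (f : K -> K^o) (z l : K) :
  is_derive (z : K^o) (1 : K^o) (f : K^o -> K^o) l -> derive1 f z = l.
Proof. by move=> [_ <-]; rewrite derive1E. Qed.

Lemma near_eq_derive1 (K : numFieldType) (f g : K -> K^o) (z d : K) : 0 < d ->
  (forall w, `|z - w| < d -> f w = g w) -> derive1 f z = derive1 g z.
Proof.
move=> d0 H; rewrite !derive1E; apply: near_eq_derive.
by apply/nbhs_ballP; exists d => // w /H.
Qed.

Section derivative.
Variable R : realType.
Local Notation Im := complex.Im.
Local Notation Re := complex.Re.
Variables (n : nat) (H : 'M[R[i]]_n).
Hypothesis HH : hermitian_mx H.
Local Notation G := (resolvent H).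

Lemma resolvent_sub (z w : R[i]) : 0 < Im z -> 0 < Im w ->
  G w - G z = (w - z) *: (G w *m G z).
Proof.
move=> z0 w0; rewrite resolvent_identity ?shift_unitmx //.
have -> : H - z%:M - (H - w%:M) = (w - z)%:M.
  by rewrite opprB addrC addrA subrK raddfB.
by rewrite mul_mx_scalar -scalemxAl.
Qed.

Lemma cabs_resolvent_entry_le (z : R[i]) i j : 0 < Im z -> cabs (G z i j) <= (Im z)^-1.
Proof.
move=> z0; have zi0 : 0 <= (Im z)^-1 by rewrite invr_ge0 ltW.
rewrite -(@ler_pXn2r _ 2) ?nnegrE ?cabs_ge0 // exprVn.
apply: (@le_trans _ _ (\sum_k cabs (G z i k) ^+ 2)).
  by rewrite (bigD1 j) //= lerDl; apply: sumr_ge0 => k _; exact: sqr_ge0.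
rewrite -(ler_pM2l z0) -ward_row // (le_trans (ler_norm _)) //.
rewrite (le_trans (Im_le_cabs _)) // (le_trans (cabs_resolvent_le HH z0 _)) //.
by rewrite expr2 invfM mulrA divff ?mul1r // gt_eqF.
Qed.

Lemma resolvent_near_bound (z w : R[i]) i j : 0 < Im z -> cabs (w - z) < Im z / 2 ->
  cabs ((G w *m G z *m G z) i j) <= 2 / Im z * \sum_k cabs ((G z *m G z) k j).
Proof.
move=> z0 wz; have w0 : Im z / 2 < Im w.
  by have := le_lt_trans (Im_le_cabs (w - z)) wz; rewrite Im_subc ltr_norml => /andP[]; lra.
rewrite -mulmxA mxE (le_trans (cabs_sum _ _ _)) // mulr_sumr.
apply: ler_sum => k _; rewrite cabsM ler_wpM2r ?cabs_ge0 //.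
rewrite (le_trans (cabs_resolvent_entry_le _ _ _)) //; first by lra.
by rewrite -invf_div lef_pV2 ?posrE; lra.
Qed.

Lemma is_derive_resolvent (z : R[i]) i j : 0 < Im z ->
  is_derive (z : (R[i])^o) (1 : (R[i])^o) (fun w : (R[i])^o => G w i j : (R[i])^o) ((G z *m G z) i j).
Proof.
move=> z0.
set f := fun w : (R[i])^o => _.
apply: is_derive_quotient => e e0.
(* The bound of [resolvent_near_bound], plus 1 so that it can be divided by. *)
pose M := 2 / Im z * \sum_k cabs ((G z *m G z) k j) + 1.
have M0 : 0 < M.
  rewrite ltr_wpDl // mulr_ge0 ?divr_ge0 ?(ltW z0) //.
  by apply: sumr_ge0 => k _; exact: cabs_ge0.
(* A positive element of [R[i]] is real, so e can be replaced by its real part. *)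
have eE : e = (complex.Re e)%:C%C by rewrite RRe_real // gtr0_real.
have {}e0 : 0 < complex.Re e by move: e0; rewrite {1}eE ltcR.
exists (Num.min (Im z / 2) (complex.Re e / M))%:C%C => [|h h0].
  by rewrite ltcR lt_min !divr_gt0.
rewrite normr_cabs ltcR lt_min => /andP[h1 h2].
pose w := h + z.
have w0 : 0 < Im w.
  by have := le_lt_trans (Im_le_cabs h) h1; rewrite /w Im_addc ltr_norml => /andP[]; lra.
have hE : h = w - z by rewrite /w addrK.
have -> : h^-1 * (f w - f z) = (G w *m G z) i j.
  have /matrixP/(_ i j) := resolvent_sub z0 w0; rewrite -hE !mxE => ->.
  by rewrite mulKf.
have -> : (G z *m G z) i j - (G w *m G z) i j = - (h * (G w *m G z *m G z) i j).
  have := resolvent_sub z0 w0 => /(congr1 (mulmx^~ (G z))) /matrixP/(_ i j).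
  by rewrite /= mulmxBl -scalemxAl -hE mxE [X in _ + X]mxE [RHS]mxE => <-; rewrite opprB.
rewrite normr_cabs eE lecR cabsN cabsM.
apply: (@le_trans _ _ (complex.Re e / M * M)); last by rewrite divfK // gt_eqF.
apply: ler_pM; rewrite ?cabs_ge0 ?(ltW h2) //.
rewrite (le_trans (resolvent_near_bound _ _ _ _)) -?hE // /M.
by rewrite lerDl.
Qed.

Lemma is_derive_resolvent2 (z : R[i]) i j : 0 < Im z ->
  is_derive (z : (R[i])^o) (1 : (R[i])^o) (fun w : (R[i])^o => (G w *m G w) i j : (R[i])^o)
    (2 * (G z *m G z *m G z) i j).
Proof.
move=> z0.
have -> : (fun w : (R[i])^o => (G w *m G w) i j : (R[i])^o) =
   \sum_(k < n) ((fun w : (R[i])^o => G w i k : (R[i])^o) * (fun w => G w k j)).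
  by apply/funext => w; rewrite mxE fct_sumE.
have h k : is_derive (z : (R[i])^o) (1 : (R[i])^o) ((fun w : (R[i])^o => G w i k : (R[i])^o) * (fun w => G w k j))
  (G z i k *: (G z *m G z) k j + G z k j *: (G z *m G z) i k).
  have h1 := is_derive_resolvent i k z0.
  have h2 := is_derive_resolvent k j z0.
  exact: is_deriveM.
apply: (is_derive_eq (is_derive_sum h)).
rewrite big_split /= mulr_natl mulr2n; congr (_ + _).
  by rewrite -mulmxA [RHS]mxE.
by rewrite [RHS]mxE; apply: eq_bigr => k _; rewrite /GRing.scale /= mulrC.
Qed.

Lemma cderiv_green x y (z : R[i]) : 0 < Im z ->
  cderiv (green H x y) z = (G z *m G z) y x.
Proof. by move=> z0; apply: is_derive_derive1; exact: is_derive_resolvent. Qed.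

Lemma cderiv2_green x y (z : R[i]) : 0 < Im z ->
  cderiv (cderiv (green H x y)) z = 2 * (G z *m G z *m G z) y x.
Proof.
move=> z0; rewrite -(is_derive_derive1 (is_derive_resolvent2 y x z0)).
(* The formula for the first derivative holds only in the upper half-plane; the disc of radius Im z
   about z lies inside it. *)
apply: (@near_eq_derive1 _ _ _ _ (Im z)%:C%C); first by rewrite ltcR.
move=> w; rewrite normr_cabs ltcR => h; rewrite cderiv_green //.
have := le_lt_trans (le_trans (ler_norm _) (Im_le_cabs (z - w))) h.
by rewrite Im_subc; lra.
Qed.
End derivative.

(** * Poisson kernels *)

Section poisson_kernel.
Variable R : realType.
Implicit Types a b s t u eta : R.

(** Im (1 / (s - (a + ib))): the Poisson kernel of the upper half-plane without its factor 1 /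
    pi. *)
Definition poisson a b s : R := b / ((s - a) ^+ 2 + b ^+ 2).

Lemma poisson_den_gt0 a b s : 0 < b -> 0 < (s - a) ^+ 2 + b ^+ 2.
Proof. by move=> b0; rewrite ltr_wpDl ?sqr_ge0 // exprn_gt0. Qed.

Lemma poisson_ge0 a b s : 0 < b -> 0 <= poisson a b s.
Proof. by move=> b0; rewrite divr_ge0 ?ltW // poisson_den_gt0. Qed.

(** From (t - a)^2 <= 2 (s - a)^2 + 2 (s - t)^2 and (s - t)^2 <= b^2, the denominators differ by a
    factor at most 3. *)
Lemma poisson_shift a b s t : 0 < b -> `|s - t| <= b -> poisson a b s <= 3 * poisson a b t.
Proof.
move=> b0 st; rewrite /poisson mulrCA ler_pM2l //.
rewrite ler_pdivlMr ?poisson_den_gt0 // mulrC ler_pdivrMr ?poisson_den_gt0 //.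
have : (s - t) ^+ 2 <= b ^+ 2 by rewrite -ler_sqrt ?sqr_ge0 // !sqrtr_sqr (gtr0_norm b0).
have := sqr_ge0 ((s - a) + (s - t)); nra.
Qed.

(* A bounded increasing function whose increments dominate the Poisson kernel,
   so that Riemann sums of the kernel telescope. *)
Definition poisson_primitive a b s : R := (s - a) / (`|s - a| + b).

Lemma poisson_primitive_bound a b s : 0 < b -> `|poisson_primitive a b s| <= 1.
Proof.
move=> b0; have d0 : 0 < `|s - a| + b by rewrite ltr_wpDl.
by rewrite normrM normfV (gtr0_norm d0) ler_pdivrMr // mul1r lerDl ltW.
Qed.

(** With u = s - a, when u and u + eta lie on the same side of 0 the increment is exactly eta b /
    ((|u| + b) (|u + eta| + b)), and eta <= b bounds that denominator by 4 (u^2 + b^2). *)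
Lemma poisson_primitive_incr a b eta s : 0 < eta -> eta <= b ->
  eta * poisson a b s <= 4 * (poisson_primitive a b (s + eta) - poisson_primitive a b s).
Proof.
move=> e0 eb; have b0 : 0 < b by exact: lt_le_trans eb.
have q0 := poisson_den_gt0 a s b0.
rewrite /poisson /poisson_primitive.
rewrite addrAC; set u := s - a in q0 *.
rewrite mulrA ler_pdivrMr //.
have [u0|u0] := leP 0 u.
  have u1 : 0 < u + b by lra.
  have u2 : 0 < u + eta + b by lra.
  rewrite (ger0_norm u0) (@ger0_norm _ (u + eta)); last by lra.
  have -> : (u + eta) / (u + eta + b) - u / (u + b) = eta * b / ((u + eta + b) * (u + b)).
    by field; rewrite !gt_eqF.
  rewrite mulrA mulrAC ler_pdivlMr ?mulr_gt0 // [4 * _]mulrC -[leRHS]mulrA.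
  rewrite ler_pM2l ?mulr_gt0 //.
  have : (u + eta + b) * (u + b) <= (u + 2 * b) * (u + b) by rewrite ler_pM2r; lra.
  have := sqr_ge0 (u - b); nra.
rewrite (ltr0_norm u0).
have [u1|u1] := leP (u + eta) 0.
  have u2 : 0 < - u + b by lra.
  have u3 : 0 < - (u + eta) + b by lra.
  rewrite (ler0_norm u1).
  have -> : (u + eta) / (- (u + eta) + b) - u / (- u + b) =
      eta * b / ((- (u + eta) + b) * (- u + b)).
    by field; rewrite !gt_eqF //; lra.
  rewrite mulrA mulrAC ler_pdivlMr ?mulr_gt0 // [4 * _]mulrC -[leRHS]mulrA.
  rewrite ler_pM2l ?mulr_gt0 //.
  have : (- (u + eta) + b) * (- u + b) <= (- u + b) * (- u + b) by rewrite ler_pM2r; lra.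
  have := sqr_ge0 (u + b); nra.
(* Across the origin, |u| and u + eta are both at most eta <= b, so both denominators of the
   primitive are at most 2 b. *)
rewrite (gtr0_norm u1).
have h1 : (u + eta) / (2 * b) <= (u + eta) / (u + eta + b).
  by rewrite ler_pM2l // lef_pV2 ?posrE; lra.
have h2 : - u / (2 * b) <= - (u / (- u + b)).
  by rewrite -mulNr ler_pM2l ?oppr_gt0 // lef_pV2 ?posrE; lra.
have h3 : eta / (2 * b) <= (u + eta) / (u + eta + b) - u / (- u + b).
  apply: le_trans (lerD h1 h2); rewrite -mulrDl.
  by rewrite addrAC subrr add0r.
apply: (@le_trans _ _ (4 * (eta / (2 * b)) * (u ^+ 2 + b ^+ 2))).
  have -> : 4 * (eta / (2 * b)) * (u ^+ 2 + b ^+ 2) = eta * b * 2 + eta * u ^+ 2 * 2 / b.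
    by field; rewrite gt_eqF.
  have : 0 <= eta * u ^+ 2 * 2 / b by apply: divr_ge0; [have := sqr_ge0 u; nra|lra].
  nra.
by rewrite ler_pM2r // ler_pM2l.
Qed.

(** The sum telescopes; 8 is 4 times the largest possible variation, 2, of a function bounded by
    1. *)
Lemma poisson_sum_le a b eta m : 0 < eta -> eta <= b ->
  \sum_(k < m) eta * poisson a b (k%:R * eta) <= 8.
Proof.
move=> e0 eb; have b0 : 0 < b by exact: lt_le_trans eb.
pose f k := poisson_primitive a b (k%:R * eta).
apply: (@le_trans _ _ (4 * (f m - f 0%N))).
  rewrite -(telescope_sumr f (leq0n m)) big_mkord mulr_sumr.
  apply: ler_sum => k _; rewrite /f -[k.+1%:R]natr1 [(k%:R + 1) * _]mulrDl mul1r.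
exact: poisson_primitive_incr.
have := poisson_primitive_bound a (m%:R * eta) b0.
have := poisson_primitive_bound a (0%:R * eta) b0.
by rewrite /f !ler_norml => /andP[? ?] /andP[? ?]; lra.
Qed.

Lemma poissonN a b s : poisson a b (- s) = poisson (- a) b s.
Proof. by rewrite /poisson; congr (_ / (_ + _)); ring. Qed.

(** Sorting by |s| lets one natural index cover both half-lines; a negative s is reflected, which
    turns a into - a. *)
Lemma poisson_abs_shift a b eta s t : 0 <= t -> t <= `|s| -> `|s| < t + eta ->
  0 < eta -> eta <= b ->
  poisson a b s <= 3 * (poisson a b t + poisson (- a) b t).
Proof.
move=> t0 ts st e0 eb; have b0 : 0 < b by exact: lt_le_trans eb.
have [s0|s0] := leP 0 s.
  rewrite (ger0_norm s0) in ts st.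
  have h : poisson a b s <= 3 * poisson a b t.
    by apply: poisson_shift => //; rewrite ler_norml; lra.
  apply: le_trans h _; rewrite ler_pM2l // lerDl; exact: poisson_ge0.
rewrite (ltr0_norm s0) in ts st.
have h : poisson a b s <= 3 * poisson a b (- t).
  by apply: poisson_shift => //; rewrite ler_norml; lra.
by apply: le_trans h _; rewrite ler_pM2l // poissonN lerDr; exact: poisson_ge0.
Qed.

(* Dyadic decomposition: the scale 2^j eta closest to r from below already gives 1 / (8 r). *)
Lemma inv_le_poisson_sum a b eta s J r : 0 < eta -> eta <= b -> 
  r ^+ 2 = (s - a) ^+ 2 + b ^+ 2 -> 0 < r -> r < 2 ^+ J * eta ->
  r^-1 <= 8 * \sum_(j < J) poisson a (b + 2 ^+ j * eta) s.
Proof.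
move=> e0 eb rE r0; have b0 : 0 < b by exact: lt_le_trans eb.
have br : b <= r.
  rewrite -(ler_pXn2r (n := 2)) ?nnegrE ?(ltW b0) ?(ltW r0) //.
  by rewrite rE lerDr sqr_ge0.
elim: J => [|J IH]; first by rewrite expr0 mul1r; lra.
rewrite big_ord_recr /=.
have t0 : 0 < 2 ^+ J * eta by rewrite mulr_gt0 ?exprn_gt0.
have p0 : 0 <= poisson a (b + 2 ^+ J * eta) s by apply: poisson_ge0; lra.
rewrite exprS.
have [/IH h _|h1 h2] := ltP r (2 ^+ J * eta); first by lra.
set t := _ * eta in t0 p0 h1 h2 *.
have {h2} h2 : r < 2 * t by rewrite /t mulrA.
apply: (@le_trans _ _ (8 * poisson a (b + t) s)); last first.
  rewrite ler_pM2l // lerDr; apply: sumr_ge0 => j _; apply: poisson_ge0.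
  by rewrite ltr_wpDr // mulr_ge0 ?exprn_ge0 ?ltW.
rewrite /poisson mulrA ler_pdivlMr; last by apply: poisson_den_gt0; lra.
rewrite mulrC ler_pdivrMr //.
(* b <= r and t <= r bound the denominator by 4 r^2, and b + t > r / 2 bounds the numerator from
   below. *)
have : (s - a) ^+ 2 + (b + t) ^+ 2 <= 4 * r ^+ 2 by nra.
nra.
Qed.
End poisson_kernel.

(** * Measurability *)

Section complex_measurability.
Variables (R : realType) (d : measure_display) (T : measurableType d).
Local Notation Im := (@complex.Im R).
Local Notation Re := (@complex.Re R).
Implicit Types f g : T -> R[i].

(** Componentwise, as in [entry_rv], which lists real and imaginary parts separately. *)
Definition cmeasurable f :=
  measurable_fun setT (Re \o f) /\ measurable_fun setT (Im \o f).

Lemma cmeasurable_cst c : cmeasurable (cst c).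
Proof. by split; exact: measurable_cst. Qed.

Lemma cmeasurableD f g : cmeasurable f -> cmeasurable g ->
  cmeasurable (fun w => f w + g w).
Proof.
move=> [rf jf] [rg jg]; split.
  rewrite (_ : _ \o _ = (Re \o f) \+ (Re \o g)); first exact: measurable_funD.
  by apply/funext => w; exact: Re_addc.
rewrite (_ : _ \o _ = (Im \o f) \+ (Im \o g)); first exact: measurable_funD.
by apply/funext => w; exact: Im_addc.
Qed.

Lemma cmeasurableM f g : cmeasurable f -> cmeasurable g ->
  cmeasurable (fun w => f w * g w).
Proof.
move=> [rf jf] [rg jg]; split.
  rewrite (_ : _ \o _ = ((Re \o f) \* (Re \o g)) \- ((Im \o f) \* (Im \o g))).
    by apply: measurable_funB; exact: measurable_funM.
  by apply/funext => w; exact: Re_mulc.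
rewrite (_ : _ \o _ = ((Re \o f) \* (Im \o g)) \+ ((Im \o f) \* (Re \o g))).
  by apply: measurable_funD; exact: measurable_funM.
by apply/funext => w; exact: Im_mulc.
Qed.

Lemma cmeasurableN f : cmeasurable f -> cmeasurable (fun w => - f w).
Proof.
move=> mf; rewrite (_ : (fun w => - f w) = (fun w => cst (-1) w * f w)).
  by apply: cmeasurableM => //; exact: cmeasurable_cst.
by apply/funext => w /=; rewrite mulN1r.
Qed.

Lemma cmeasurable_sum (I : Type) (r : seq I) (P : pred I) (F : I -> T -> R[i]) :
  (forall i, cmeasurable (F i)) -> cmeasurable (fun w => \sum_(i <- r | P i) F i w).
Proof.
move=> mF; elim: r => [|i r IH].
  by under eq_fun do rewrite big_nil; exact: cmeasurable_cst.
under eq_fun do rewrite big_cons.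
by case: (P i) => //; exact: cmeasurableD.
Qed.

Lemma cmeasurable_prod (I : Type) (r : seq I) (P : pred I) (F : I -> T -> R[i]) :
  (forall i, cmeasurable (F i)) -> cmeasurable (fun w => \prod_(i <- r | P i) F i w).
Proof.
move=> mF; elim: r => [|i r IH].
  by under eq_fun do rewrite big_nil; exact: cmeasurable_cst.
under eq_fun do rewrite big_cons.
by case: (P i) => //; exact: cmeasurableM.
Qed.

Lemma measurable_invr (f : T -> R) : (forall w, 0 <= f w) ->
  measurable_fun setT f -> measurable_fun setT (fun w => (f w)^-1).
Proof.
(* The power -1 agrees with the inverse on nonnegative reals, 0 included, where both are 0. *)
move=> f0 mf; rewrite (_ : (fun w => _) = (fun x => x `^ (-1)) \o f).
  by apply: measurableT_comp => //; exact: measurable_powR.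
by apply/funext => w /=; rewrite powR_inv1.
Qed.

Lemma measurable_sqr_cabs f : cmeasurable f ->
  measurable_fun setT (fun w => cabs (f w) ^+ 2).
Proof.
move=> [rf jf]; under eq_fun do rewrite sqr_cabs.
by apply: measurable_funD; exact: measurable_funX.
Qed.

Lemma cmeasurableV f : cmeasurable f -> cmeasurable (fun w => (f w)^-1).
Proof.
move=> mf; have := mf => -[rf jf].
have E w : (f w)^-1 = (Re (f w) / cabs (f w) ^+ 2 -i* (Im (f w) / cabs (f w) ^+ 2))%C.
  by rewrite sqr_cabs; case: (f w).
have mV : measurable_fun setT (fun w => (cabs (f w) ^+ 2)^-1).
  by apply: measurable_invr; [move=> w; exact: sqr_ge0|exact: measurable_sqr_cabs].
split.
  rewrite (_ : _ \o _ = (Re \o f) \* (fun w => (cabs (f w) ^+ 2)^-1)).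
    exact: measurable_funM.
  by apply/funext => w /=; rewrite E.
rewrite (_ : _ \o _ = \- ((Im \o f) \* (fun w => (cabs (f w) ^+ 2)^-1))).
  by apply: measurableT_comp => //; exact: measurable_funM.
by apply/funext => w /=; rewrite E.
Qed.

Lemma measurable_cabs f : cmeasurable f -> measurable_fun setT (fun w => cabs (f w)).
Proof.
move=> mf; rewrite (_ : (fun w => _) = (fun x => x `^ (2^-1)) \o (fun w => cabs (f w) ^+ 2)).
  by apply: measurableT_comp; [exact: measurable_powR|exact: measurable_sqr_cabs].
by apply/funext => w /=; rewrite powR12_sqrt ?sqr_ge0 // sqrtr_sqr ger0_norm ?cabs_ge0.
Qed.

Lemma cmeasurable_det n (A : T -> 'M[R[i]]_n) :
  (forall i j, cmeasurable (fun w => A w i j)) -> cmeasurable (fun w => \det (A w)).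
Proof.
move=> mA; apply: cmeasurable_sum => s; apply: cmeasurableM; first exact: cmeasurable_cst.
exact: cmeasurable_prod.
Qed.

(** By Cramer's rule the entries are quotients of polynomials in the entries of A. *)
Lemma cmeasurable_invmx n (A : T -> 'M[R[i]]_n) i j :
  (forall w, A w \in unitmx) ->
  (forall i j, cmeasurable (fun w => A w i j)) -> cmeasurable (fun w => invmx (A w) i j).
Proof.
move=> uA mA; rewrite (_ : (fun w => _) = fun w => (\det (A w))^-1 * cofactor (A w) j i).
  apply: cmeasurableM; first by apply: cmeasurableV; exact: cmeasurable_det.
  apply: cmeasurableM; first exact: cmeasurable_cst.
  apply: cmeasurable_det => k l.
  by under eq_fun do rewrite !mxE; exact: mA.
by apply/funext => w; rewrite /invmx uA !mxE.
Qed.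

Lemma cmeasurable_resolvent n (H : T -> 'M[R[i]]_n) (z : R[i]) i j :
  (forall w, hermitian_mx (H w)) -> 0 < Im z ->
  (forall i j, cmeasurable (fun w => H w i j)) ->
  cmeasurable (fun w => resolvent (H w) z i j).
Proof.
move=> HH z0 mH; apply: cmeasurable_invmx => [w|k l]; first exact: shift_unitmx.
under eq_fun do rewrite !mxE.
by apply: cmeasurableD => //; exact: cmeasurable_cst.
Qed.

Lemma cmeasurable_mulmx n m p (A : T -> 'M[R[i]]_(n, m)) (B : T -> 'M[R[i]]_(m, p)) i j :
  (forall i j, cmeasurable (fun w => A w i j)) ->
  (forall i j, cmeasurable (fun w => B w i j)) ->
  cmeasurable (fun w => (A w *m B w) i j).
Proof.
move=> mA mB; under eq_fun do rewrite mxE.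
by apply: cmeasurable_sum => k; exact: cmeasurableM.
Qed.

End complex_measurability.

(** * Averaging over one site *)

(* [pushforward] is a measure only up to the proof [mf], which unification cannot guess. *)
Definition image_measure d d' (T1 : measurableType d) (T2 : measurableType d')
    (R : realType) (m : {measure set T1 -> \bar R}) (f : T1 -> T2)
    (mf : measurable_fun setT f) : {measure set T2 -> \bar R} :=
  measure_function_pushforward__canonical__measure_function_Measure m mf.

Section conditional_bound.
Local Open Scope ereal_scope.
Context (R : realType) (d : measure_display) (Omega : measurableType d).
Variable P : probability Omega R.
Implicit Type G : set (set Omega).

Lemma measurable_fun_coarser (d' : measure_display) (T : measurableType d') G
    (f : g_sigma_algebraType G -> T) :
  G `<=` d.-measurable -> measurable_fun setT f -> measurable_fun setT (f : Omega -> T).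
Proof.
move=> mG mf _ A mA; have sG := smallest_sub (@sigma_algebra_measurable _ Omega) mG.
by apply: sG; exact: mf.
Qed.

Lemma measurable_idfun_coarser G : G `<=` d.-measurable ->
  measurable_fun setT (idfun : Omega -> g_sigma_algebraType G).
Proof.
by move=> mG; apply: (@measurable_fun_coarser _ (g_sigma_algebraType G) G idfun) => // _ A mA; rewrite setTI.
Qed.

(** Stands in for conditional expectation: A |-> P(D & A) and c P are compared as measures on the
    coarser sigma-algebra, the only place where the inequality holds. Pushing forward along the
    identity moves them there. *)
Lemma integral_cond_le (D : set Omega) G (c : R) (F : g_sigma_algebraType G -> \bar R) :
  d.-measurable D -> G `<=` d.-measurable -> (0 <= c)%R ->
  (forall A, <<s G >> A -> P (D `&` A) <= c%:E * P A) ->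
  (forall w, 0 <= F w) -> measurable_fun setT F ->
  \int[P]_(w in D) F w <= c%:E * \int[P]_w F w.
Proof.
move=> mD mG c0 PD F0 mF.
have mF' : measurable_fun setT (F : Omega -> \bar R) by exact: measurable_fun_coarser.
have mid := measurable_idfun_coarser mG.
pose m1 := image_measure (mrestr P mD) mid.
pose m2 := mscale (NngNum c0) (image_measure P mid).
have m12 : forall S, measurable S -> m1 S <= m2 S.
  by move=> S mS; rewrite /m1 /m2 /mscale /= /pushforward /mrestr /= setIC; exact: PD.
have -> : \int[P]_(w in D) F w = \int[mrestr P mD]_(w in D) F w.
  apply: eq_measure_integral => A mA AD.
  by rewrite /= /mrestr setIidl.
apply: (@le_trans _ _ (\int[mrestr P mD]_w F w)); first exact: ge0_subset_integral.
have -> : \int[mrestr P mD]_w F w = \int[m1]_w F w.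
  by rewrite ge0_integral_pushforward.
apply: (le_trans (ge0_le_measure_integral m12 _ _ _)) => //.
by rewrite ge0_integral_mscale //= ge0_integral_pushforward.
Qed.
End conditional_bound.

Section poisson_average.
Local Open Scope ereal_scope.
Context (R : realType) (d : measure_display) (Omega : measurableType d).
Variables (P : probability Omega R) (G : set (set Omega)) (X : Omega -> R) (c : R).
Hypotheses (mG : G `<=` d.-measurable) (mX : measurable_fun setT X) (c0 : (0 <= c)%R).
Hypothesis PX : forall (I : set R) (A : set Omega), measurable I -> <<s G >> A ->
  P (X @^-1` I `&` A) <= c%:E * lebesgue_measure I * P A.

Lemma lebesgue_measure_annulus (t eta : R) : (0 < eta)%R ->
  lebesgue_measure [set x : R | (t <= `|x| < t + eta)%R] <= (2 * eta)%:E.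
Proof.
move=> e0; set A := [set x | _].
have sA : A `<=` `[t, (t + eta)%R]%classic `|` `[(- t - eta)%R, (- t)%R]%classic.
  move=> x; rewrite /A /= !in_itv /=; have [x0|x0] := leP 0%R x.
    by rewrite ger0_norm // => /andP[? ?]; left; lra.
  by rewrite ltr0_norm // => /andP[? ?]; right; lra.
have mA : measurable A.
  rewrite (_ : A = setT `&` Num.norm @^-1` `[t, (t + eta)%R[%classic).
    by apply: normr_measurable => //; exact: measurable_itv.
  by apply/seteqP; split => x /=; rewrite in_itv //= => -[].
apply: (le_trans (le_measure lebesgue_measure _ _ sA)); rewrite ?inE //.
  by apply: measurableU; exact: measurable_itv.
apply: (le_trans (measureU2 _ _ _)); [exact: measurable_itv..|].
have E u v : (v - u = eta)%R -> lebesgue_measure `[u, v]%classic = eta%:E.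
  move=> uv; rewrite lebesgue_measure_itv /= lte_fin -subr_gt0 uv e0.
  by rewrite -EFinB uv.
have -> : (2 * eta)%:E = eta%:E + eta%:E by rewrite -EFinD mulr_natl mulr2n.
have E1 : (t + eta - t = eta)%R by ring.
have E2 : (- t - (- t - eta) = eta)%R by ring.
by apply: leeD; [rewrite -(E _ _ E1)|rewrite -(E _ _ E2)].
Qed.

(** On the annulus k eta <= |X| < (k + 1) eta the kernel at X is dominated by kernels at the grid
    point k eta, which no longer involve X; the conditional bound then charges 2 c eta for the
    annulus. Summing over k uses [poisson_sum_le]. *)
Lemma poisson_average (eta : R) (K a b : g_sigma_algebraType G -> R) :
  (0 < eta)%R -> (forall w, 0 <= K w)%R -> (forall w, eta <= b w)%R ->
  measurable_fun setT K -> measurable_fun setT a -> measurable_fun setT b ->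
  \int[P]_w (K w * poisson (a w) (b w) (X w))%:E <= (96 * c)%:E * \int[P]_w (K w)%:E.
Proof.
move=> e0 K0 eb mK ma mb.
have b0 w : (0 < b w)%R by exact: lt_le_trans (eb w).
have coarse (f : g_sigma_algebraType G -> R) : measurable_fun setT f ->
    measurable_fun setT (f : Omega -> R) by exact: measurable_fun_coarser.
have mpois (d' : measure_display) (T : measurableType d') (f g s : T -> R) :
    (forall w, 0 < g w)%R ->
    measurable_fun setT f -> measurable_fun setT g -> measurable_fun setT s ->
    measurable_fun setT (fun w => poisson (f w) (g w) (s w)).
  move=> g0 mf mg ms; apply: measurable_funM => //; apply: measurable_invr => [w|].
    exact/ltW/poisson_den_gt0.
  by apply: measurable_funD; apply: measurable_funX => //; exact: measurable_funB.
pose I k := [set x : R | (k%:R * eta <= `|x| < k%:R * eta + eta)%R].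
have mI k : measurable (I k).
  rewrite (_ : I k = setT `&` Num.norm @^-1` `[(k%:R * eta)%R, (k%:R * eta + eta)%R[%classic).
    by apply: normr_measurable => //; exact: measurable_itv.
  by apply/seteqP; split => x /=; rewrite in_itv //= => -[].
pose F k := X @^-1` I k.
have mF k : measurable (F k) by rewrite -[F k]setTI; exact: mX.
have tF : trivIset setT F.
  apply/trivIsetP => i j _ _ ij; rewrite -subset0 => w [].
  rewrite /F /I /= => /andP[i1 i2] /andP[j1 j2].
  have key (m n : nat) : (m%:R * eta <= `|X w|)%R -> (`|X w| < n%:R * eta + eta)%R -> (m <= n)%N.
    move=> h1 h2; rewrite -ltnS -(ltr_nat R) -(ltr_pM2r e0) -natr1 mulrDl mul1r.
    exact: le_lt_trans h2.
  by move/negP: ij; apply; rewrite eqn_leq !key.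
have UF : \bigcup_k F k = setT.
  rewrite -subTset => w _.
  have h0 : (0 <= `|X w| / eta)%R by rewrite divr_ge0 // ltW.
  exists (Num.trunc (`|X w| / eta)) => //; rewrite /F /I /=.
  have /andP[] := truncn_itv h0.
  rewrite ler_pdivlMr // ltr_pdivrMr // => -> /=.
  by rewrite -natr1 mulrDl mul1r.
pose h w := (K w * poisson (a w) (b w) (X w))%:E.
have mh : measurable_fun [set: Omega] h.
  by apply/measurable_EFinP; apply: measurable_funM; [exact: coarse|apply: mpois => //; exact: coarse].
have h0 w : 0 <= h w by rewrite lee_fin mulr_ge0 // poisson_ge0.
(* The majorant on the k-th annulus, measurable for the conditioning sigma-algebra. *)
pose q k w : R := (3 * K w * (poisson (a w) (b w) (k%:R * eta) + poisson (- a w) (b w) (k%:R * eta)))%R.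
have q0 k w : (0 <= q k w)%R by rewrite !mulr_ge0 // addr_ge0 // poisson_ge0.
have mq k : measurable_fun [set: g_sigma_algebraType G] (q k).
  apply: measurable_funM; first exact: measurable_funM.
  apply: measurable_funD; apply: mpois => //.
  exact: measurableT_comp.
rewrite -[in leLHS]UF ge0_integral_bigcup //; [|by rewrite UF|by move=> w _; exact: h0].
apply: lime_le; first by apply: is_cvg_nneseries => n _ _; apply: integral_ge0 => w _; exact: h0.
apply: nearW => m.
apply: (@le_trans _ _ (\sum_(0 <= k < m) (c * (2 * eta))%:E * \int[P]_w (q k w)%:E)).
  apply: lee_sum => k _.
  apply: (@le_trans _ _ (\int[P]_(w in F k) (q k w)%:E)).
    apply: ge0_le_integral => //.
    - by move=> w _; exact: h0.
    - exact: measurable_funTS.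
    - by apply: measurable_funTS; apply/measurable_EFinP; exact: coarse.
    move=> w /andP[w1 w2]; rewrite lee_fin /q [(3 * _)%R]mulrC -mulrA ler_wpM2l //.
    by apply: (poisson_abs_shift (a w) _ w1 w2 e0 (eb w)); rewrite mulr_ge0 ?ler0n ?(ltW e0).
  apply: (@integral_cond_le _ _ _ P (F k) G) => //.
  - by rewrite mulr_ge0 // mulr_ge0 // ltW.
  - move=> A GA; apply: (le_trans (PX (mI k) GA)).
    rewrite lee_wpmul2r // EFinM lee_wpmul2l //.
    exact: lebesgue_measure_annulus.
  - by move=> w; rewrite lee_fin.
  - by apply/measurable_EFinP; exact: mq.
have mq' k : measurable_fun [set: Omega] (EFin \o q k) by apply/measurable_EFinP; exact: coarse.
have mK' : measurable_fun [set: Omega] (EFin \o K) by apply/measurable_EFinP; exact: coarse.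
rewrite -ge0_sume_distrr; last by move=> k _; apply: integral_ge0 => w _; rewrite lee_fin.
rewrite -ge0_integral_sum //; last by move=> k w _; rewrite lee_fin.
rewrite -!ge0_integralZl_EFin //; last first.
- by rewrite !mulr_ge0 // ltW.
- exact: emeasurable_sum.
- by move=> w _; apply: sume_ge0 => k _; rewrite lee_fin.
- by rewrite mulr_ge0.
- by move=> w _; rewrite lee_fin.
apply: ge0_le_integral => //.
- by move=> w _; rewrite mule_ge0 ?lee_fin ?mulr_ge0 ?(ltW e0) // sume_ge0 // => k _; rewrite lee_fin.
- by apply: measurable_funeM; exact: emeasurable_sum.
- by apply: measurable_funeM.
move=> w _; rewrite sumEFin -!EFinM lee_fin.
have s1 := poisson_sum_le (a w) m e0 (eb w).
have s2 := poisson_sum_le (- a w)%R m e0 (eb w).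
(* Here 96 arises as 6 (8 + 8): annulus length 2, shift factor 3, and one grid sum for each of a and
   - a. *)
have -> : (c * (2 * eta) * \sum_(0 <= k < m) q k w =
    6 * c * K w * (\sum_(k < m) eta * poisson (a w) (b w) (k%:R * eta) +
                  \sum_(k < m) eta * poisson (- a w) (b w) (k%:R * eta)))%R.
  rewrite -big_split big_mkord !mulr_sumr; apply: eq_bigr => k _.
  rewrite /q /=; ring.
have : (0 <= 6 * c * K w)%R by rewrite !mulr_ge0.
nra.
Qed.
End poisson_average.

(** * Dependence of the resolvent on a single site *)

Section update.
Variables (R : realType) (n : nat).
Local Notation Im := (@complex.Im R).
Local Notation Re := (@complex.Re R).

Definition upd (v : 'I_n -> R) (x : 'I_n) (s : R) : 'I_n -> R :=
  fun y => if y == x then s else v y.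

Lemma upd_same v x : upd v x (v x) = v.
Proof. by apply/funext => y; rewrite /upd; case: eqP => // ->. Qed.

Lemma hermitian_hamiltonian (T : 'M[R[i]]_n) v : hermitian_mx T -> hermitian_mx (hamiltonian T v).
Proof.
move=> TH; apply/matrixP => i j; rewrite -{2}TH !mxE rmorphD /=.
congr (_ + _); rewrite eq_sym; case: eqP => [->|]; first by rewrite !mulr1n conjc_real.
by rewrite !mulr0n conjc0.
Qed.

Lemma hamiltonian_upd (T : 'M[R[i]]_n) v x s :
  hamiltonian T (upd v x s) = hamiltonian T (upd v x 0) + s%:C%C *: delta_mx x x.
Proof.
apply/matrixP => i j; rewrite !mxE -addrA; congr (_ + _).
rewrite /upd; have [->|ix] := eqVneq i x.
  rewrite [j == x]eq_sym; case: (x == j); first by rewrite !mulr1n mulr1 add0r.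
  by rewrite !mulr0n mulr0 addr0.
by rewrite /= mulr0 addr0.
Qed.

End update.

Section pointwise.
Variables (R : realType) (n : nat) (T : 'M[R[i]]_n) (z : R[i]).
Local Notation Im := (@complex.Im R).
Local Notation Re := (@complex.Re R).
Hypotheses (TH : hermitian_mx T) (z0 : 0 < Im z).
Implicit Types (v : 'I_n -> R) (x y : 'I_n).

Definition res v := resolvent (hamiltonian T v) z.

(* By rank-one perturbation theory G(x,x) = 1 / (V(x) - site_pole), with a pole that does not depend on V(x). *)
Definition site_pole v x : R[i] := - (res (upd v x 0) x x)^-1.

Lemma res_site v x s : res (upd v x s) x x = (s%:C%C - site_pole v x)^-1.
Proof.
rewrite /res hamiltonian_upd rank_one_diag //; first exact: hermitian_hamiltonian.
by rewrite -hamiltonian_upd; exact: hermitian_hamiltonian.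
Qed.

Lemma site_pole_Im_ge v x : Im z <= Im (site_pole v x).
Proof. by apply: Im_inv_le => //; exact: hermitian_hamiltonian. Qed.

Lemma Im_res_site v x s :
  Im (res (upd v x s) x x) = poisson (Re (site_pole v x)) (Im (site_pole v x)) s.
Proof. by rewrite res_site Im_invB. Qed.

(** If the distance to the pole is below 2^J Im z, the dyadic sum applies; otherwise it is at least
    1, and the summand 1 suffices. *)
Lemma cabs_res_site_le v x s J : 1 <= 2 ^+ J * Im z ->
  cabs (res (upd v x s) x x) <= 1 + 8 * \sum_(j < J)
    poisson (Re (site_pole v x)) (Im (site_pole v x) + 2 ^+ j * Im z) s.
Proof.
move=> J1; rewrite res_site cabsV.
set w := site_pole v x; have ew : Im z <= Im w by exact: site_pole_Im_ge.
have w0 : 0 < Im w by exact: lt_le_trans ew.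
have rE : cabs (s%:C%C - w) ^+ 2 = (s - Re w) ^+ 2 + Im w ^+ 2.
  by rewrite sqr_cabs Re_subc Im_subc /= sub0r sqrrN.
have r0 : 0 < cabs (s%:C%C - w).
  rewrite lt0r cabs_ge0 andbT; apply: contraTneq (poisson_den_gt0 (Re w) s w0).
  by rewrite -rE => ->; rewrite expr0n ltxx.
have S0 : 0 <= \sum_(j < J) poisson (Re w) (Im w + 2 ^+ j * Im z) s.
  apply: sumr_ge0 => j _; apply: poisson_ge0.
  by rewrite ltr_wpDr // mulr_ge0 ?exprn_ge0 ?ltW.
have [h|h] := ltP (cabs (s%:C%C - w)) (2 ^+ J * Im z).
  have := inv_le_poisson_sum z0 ew rE r0 h; lra.
have : (cabs (s%:C%C - w))^-1 <= 1 by rewrite invf_le1 //; exact: le_trans h.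
lra.
Qed.

(** Of the 2 / (n Im z), one half pays for the change of trace and the other for the term u = x,
    which must go: with V(x) frozen at 0, it can no longer be averaged over V(x). *)
Lemma cabs_stieltjes_le v x :
  cabs (stieltjes (hamiltonian T v) z) <=
  2 / (n%:R * Im z) + n%:R^-1 * \sum_(u | u != x) cabs (res (upd v x 0) u u).
Proof.
have n0 : 0 < n%:R :> R by rewrite ltr0n (leq_ltn_trans _ (ltn_ord x)).
rewrite /stieltjes cabsM cabsV cabs_nat.
have h := @rank_one_trace_le _ _ (hamiltonian T (upd v x 0)) z x (v x)
  (hermitian_hamiltonian _ TH) z0.
rewrite -hamiltonian_upd upd_same in h.
have {}h := h (hermitian_hamiltonian _ TH).
rewrite -/(res v) -/(res (upd v x 0)) in h.
have h1 : cabs (\tr (res (upd v x 0))) <=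
    (Im z)^-1 + \sum_(u | u != x) cabs (res (upd v x 0) u u).
  rewrite /mxtrace (le_trans (cabs_sum _ _ _)) // (bigD1 x) //= lerD2r.
  by apply: cabs_resolvent_le => //; exact: hermitian_hamiltonian.
have h2 : cabs (\tr (res v)) <= cabs (\tr (res v) - \tr (res (upd v x 0))) + cabs (\tr (res (upd v x 0))).
  by rewrite -{1}[\tr (res v)](subrK (\tr (res (upd v x 0)))) cabsD.
rewrite -/(resolvent _ _) -/(res v).
have -> : 2 / (n%:R * Im z) = n%:R^-1 * (2 / Im z) by field; rewrite !gt_eqF.
rewrite -mulrDr ler_pM2l ?invr_gt0 //; lra.
Qed.

End pointwise.

(** * Expectations for a fixed kinetic term *)

Section fixed_kinetic_term.
Local Open Scope ereal_scope.
Context (R : realType) (d : measure_display) (Omega : measurableType d).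
Local Notation Im := (@complex.Im R).
Local Notation Re := (@complex.Re R).
Variables (P : probability Omega R) (n : nat) (T : 'M[R[i]]_n) (z : R[i]).
Variables (V : Omega -> 'I_n -> R) (c : R).
Hypotheses (TH : hermitian_mx T) (z0 : (0 < Im z)%R) (c0 : (0 <= c)%R).
Hypothesis mV : forall x, measurable_fun setT (V ^~ x).

(** Spelled like the generators inside [gen_sigma], so that the hypothesis of the theorem is [PV] by
    conversion. *)
Definition other_sites (x : 'I_n) : set (set Omega) :=
  [set A | exists y (B : set R), [/\ y != x, measurable B & A = V ^~ y @^-1` B]].

Hypothesis PV : forall (x : 'I_n) (I : set R) (A : set Omega), measurable I ->
  <<s other_sites x >> A ->
  P (V ^~ x @^-1` I `&` A) <= c%:E * lebesgue_measure I * P A.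

Local Notation Om x := (g_sigma_algebraType (other_sites x)).
Local Notation G := (res T z).

Lemma other_sites_measurable x : other_sites x `<=` d.-measurable.
Proof. by move=> _ [y [B [_ mB ->]]]; rewrite -[X in measurable X]setTI; exact: mV. Qed.

Lemma measurable_other_site x y : y != x ->
  measurable_fun [set: Om x] (V ^~ y : Om x -> R).
Proof.
by move=> yx _ B mB; rewrite setTI; apply: sub_sigma_algebra; exists y, B.
Qed.

Lemma cmeasurable_res d' (S : measurableType d') (v : S -> 'I_n -> R) x y :
  (forall u, measurable_fun setT (v ^~ u)) -> cmeasurable (fun w => G (v w) x y).
Proof.
move=> mv; apply: cmeasurable_resolvent => //.
  by move=> w; exact: hermitian_hamiltonian.
move=> i j; under eq_fun do rewrite !mxE; apply: cmeasurableD; first exact: cmeasurable_cst.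
case: (i == j); last by under eq_fun do rewrite mulr0n; exact: cmeasurable_cst.
under eq_fun do rewrite mulr1n.
by split; [exact: mv|exact: measurable_cst].
Qed.

Lemma measurable_upd d' (S : measurableType d') (v : S -> 'I_n -> R) (s : S -> R) x y :
  (y != x -> measurable_fun setT (v ^~ y)) -> measurable_fun setT s ->
  measurable_fun setT (fun w => upd (v w) x (s w) y).
Proof.
move=> mv ms; rewrite /upd; case: eqP => [//|/eqP yx]; exact: mv.
Qed.

Lemma integral_cst_probability (r : R) : \int[P]_w r%:E = r%:E.
Proof.
have := integral_cst P measurableT r%:E; rewrite /cst => ->.
by rewrite -[RHS]mule1; congr (_ * _); exact: probability_setT.
Qed.

Section site.
Variables (x : 'I_n) (v : Om x -> 'I_n -> R).
Hypothesis mv : forall y, y != x -> measurable_fun setT (v ^~ y).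

Lemma cmeasurable_site_pole : cmeasurable (fun w : Om x => site_pole T z (v w) x).
Proof.
apply: cmeasurableN; apply: cmeasurableV; apply: cmeasurable_res => u.
by apply: measurable_upd => [|]; [exact: mv|exact: measurable_cst].
Qed.

Lemma integral_Im_res_le (K : Om x -> R) :
  (forall w, 0 <= K w)%R -> measurable_fun setT K ->
  \int[P]_w (K w * Im (G (upd (v w) x (V w x)) x x))%:E <=
  (96 * c)%:E * \int[P]_w (K w)%:E.
Proof.
move=> K0 mK; under eq_integral do rewrite Im_res_site //.
have [mr mi] := cmeasurable_site_pole.
apply: (@poisson_average _ _ _ P (other_sites x) (V ^~ x) c _ _ c0 _ (Im z)) => //.
- exact: other_sites_measurable.
- by move=> I A mI; exact: PV.
- by move=> w; exact: site_pole_Im_ge.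
Qed.

(** Each of the J kernels costs 96 c and carries the factor 8, whence 768. The potential [v] need
    not be [V]: it is used below with another site frozen at 0. *)
Lemma integral_cabs_res_le J : (1 <= 2 ^+ J * Im z)%R ->
  \int[P]_w (cabs (G (upd (v w) x (V w x)) x x))%:E <= (1 + 768 * c * J%:R)%:E.
Proof.
move=> J1.
have [mr mi] := cmeasurable_site_pole.
have coarse (f : Om x -> R) : measurable_fun setT f ->
    measurable_fun setT (f : Omega -> R).
  by apply: measurable_fun_coarser; exact: other_sites_measurable.
pose b j w := (Im (site_pole T z (v w) x) + 2 ^+ j * Im z)%R.
(* The factor 1 is the trivial weight [K] of [poisson_average]. *)
pose p j (w : Omega) := (1 * poisson (Re (site_pole T z (v w) x)) (b j w) (V w x))%R.
have b0 j w : (0 < b j w)%R.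
  rewrite /b ltr_wpDr ?(lt_le_trans z0 (site_pole_Im_ge _ _ _ _)) //.
  by rewrite mulr_ge0 ?exprn_ge0 ?(ltW z0).
have p0 j w : (0 <= p j w)%R by rewrite /p mul1r; exact: poisson_ge0.
have mb j : measurable_fun [set: Om x] (b j) by apply: measurable_funD.
have mp j : measurable_fun [set: Omega] (p j).
  apply: measurable_funM => //; apply: measurable_funM; first exact: coarse.
  apply: measurable_invr => [w|]; first exact/ltW/poisson_den_gt0.
  apply: measurable_funD; apply: measurable_funX; last exact: coarse.
  by apply: measurable_funB => //; exact: coarse.
have hp j : \int[P]_w (p j w)%:E <= (96 * c)%:E.
  apply: (@le_trans _ _ ((96 * c)%:E * \int[P]_w (1%:E : \bar R))).
    apply: (@poisson_average _ _ _ P (other_sites x) (V ^~ x) c _ _ c0 _ (Im z)) => //.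
    - exact: other_sites_measurable.
    - by move=> I A mI; exact: PV.
    - move=> w; rewrite /b ler_wpDr ?site_pole_Im_ge //.
      by rewrite mulr_ge0 ?exprn_ge0 ?(ltW z0).
  by rewrite integral_cst_probability mule1.
apply: (@le_trans _ _ (\int[P]_w (1 + \sum_(j < J) (8%:E * (p j w)%:E)))).
  apply: ge0_le_integral => //.
  - by move=> w _; rewrite lee_fin cabs_ge0.
  - apply/measurable_EFinP; apply: measurable_cabs; apply: cmeasurable_res => u.
    by apply: measurable_upd => // ux; apply: coarse; exact: mv.
  - apply: emeasurable_funD => //; apply: emeasurable_sum => j.
    by apply: measurable_funeM; exact/measurable_EFinP.
  move=> w _; under eq_bigr do rewrite -EFinM.
  rewrite sumEFin -EFinD lee_fin -mulr_sumr.
  under eq_bigr do rewrite /p mul1r.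
  exact: cabs_res_site_le.
rewrite ge0_integralD //; last 2 first.
- by move=> w _; rewrite sume_ge0 // => j _; rewrite mule_ge0 ?lee_fin.
- by apply: emeasurable_sum => j; apply: measurable_funeM; exact/measurable_EFinP.
rewrite integral_cst_probability [leRHS]EFinD. apply: leeD2l.
rewrite ge0_integral_sum //; last 2 first.
- by move=> j; apply: measurable_funeM; exact/measurable_EFinP.
- by move=> j w _; rewrite mule_ge0 ?lee_fin.
apply: (@le_trans _ _ (\sum_(j < J) (768 * c)%:E)).
  apply: lee_sum => j _; rewrite ge0_integralZl_EFin //; last 2 first.
  - by move=> w _; rewrite lee_fin.
  - exact/measurable_EFinP.
  rewrite (_ : 768 * c = 8 * (96 * c))%R; last by ring.
  by rewrite EFinM lee_pmul2l ?lte_fin.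
by rewrite sumEFin lee_fin sumr_const card_ord mulr_natr.
Qed.
End site.

Lemma integral_Im_res_diag_le x :
  \int[P]_w (Im (G (V w) x x))%:E <= (96 * c)%:E.
Proof.
have := @integral_Im_res_le x V (@measurable_other_site x) (fun=> 1%R) (fun=> ler01) (measurable_cst _).
rewrite integral_cst_probability mule1; apply: le_trans.
by under [leRHS]eq_integral do rewrite /= mul1r upd_same.
Qed.

Lemma integral_le_scaled_sum (f A B : Omega -> R) (k M : R) :
  measurable_fun setT f -> measurable_fun setT A -> measurable_fun setT B ->
  (forall w, 0 <= f w)%R -> (forall w, 0 <= A w)%R -> (forall w, 0 <= B w)%R -> (0 <= k)%R ->
  (forall w, f w <= k * (A w + B w))%R ->
  \int[P]_w (A w)%:E <= M%:E -> \int[P]_w (B w)%:E <= M%:E ->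
  \int[P]_w (f w)%:E <= (k * (M + M))%:E.
Proof.
move=> mf mA mB f0 A0 B0 k0 fAB AM BM.
have mA' : measurable_fun setT (EFin \o A) by exact/measurable_EFinP.
have mB' : measurable_fun setT (EFin \o B) by exact/measurable_EFinP.
apply: (@le_trans _ _ (\int[P]_w (k%:E * ((A w)%:E + (B w)%:E)))).
  apply: ge0_le_integral => //.
  - by move=> w _; rewrite lee_fin.
  - exact/measurable_EFinP.
  - by apply: measurable_funeM; exact: emeasurable_funD.
  - by move=> w _; rewrite -EFinD -EFinM lee_fin.
rewrite ge0_integralZl_EFin //; last 2 first.
- by move=> w _; rewrite adde_ge0 ?lee_fin.
- exact: emeasurable_funD.
rewrite ge0_integralD //; last 2 first.
- by move=> w _; rewrite lee_fin.
- by move=> w _; rewrite lee_fin.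
by rewrite EFinM EFinD; apply: lee_wpmul2l; [rewrite lee_fin|exact: leeD].
Qed.

Lemma cmeasurable_resV x y : cmeasurable (fun w => G (V w) x y).
Proof. exact: cmeasurable_res. Qed.

Lemma measurable_Im_res x : measurable_fun setT (fun w => Im (G (V w) x x)).
Proof. exact: (cmeasurable_resV x x).2. Qed.

Lemma Im_res_ge0 v x : (0 <= Im (G v x x))%R.
Proof. by apply: Im_resolvent_ge0 => //; exact: hermitian_hamiltonian. Qed.

Lemma integral_res3_le x y :
  \int[P]_w (cabs ((2 * n%:R)^-1 * (2 * (G (V w) *m G (V w) *m G (V w)) y x)))%:E <=
  (96 * c / (n%:R * Im z ^+ 2))%:E.
Proof.
have n0 : (0 < n%:R :> R)%R by rewrite ltr0n (leq_ltn_trans _ (ltn_ord x)).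
have -> : (96 * c / (n%:R * Im z ^+ 2) =
    n%:R^-1 * (2 * Im z ^+ 2)^-1 * (96 * c + 96 * c))%R.
  by field; rewrite !gt_eqF.
apply: (integral_le_scaled_sum (A := fun w => Im (G (V w) x x)) (B := fun w => Im (G (V w) y y))).
- apply: measurable_cabs; apply: cmeasurableM; first exact: cmeasurable_cst.
  apply: cmeasurableM; first exact: cmeasurable_cst.
  apply: cmeasurable_mulmx => i j; last exact: cmeasurable_resV.
  by apply: cmeasurable_mulmx => k l; exact: cmeasurable_resV.
- exact: measurable_Im_res.
- exact: measurable_Im_res.
- by move=> w; exact: cabs_ge0.
- by move=> w; exact: Im_res_ge0.
- by move=> w; exact: Im_res_ge0.
- by rewrite mulr_ge0 ?invr_ge0 ?(ltW n0) // mulr_ge0 // exprn_ge0 // ltW.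
- move=> w; rewrite !cabsM cabsV cabsM !cabs_nat; set q := cabs _.
  have -> : ((2 * n%:R)^-1 * (2 * q) = n%:R^-1 * q)%R by field; rewrite gt_eqF.
  rewrite -[leRHS]mulrA ler_pM2l ?invr_gt0 // [leRHS]mulrC.
  by apply: resolvent3_le => //; exact: hermitian_hamiltonian.
- exact: integral_Im_res_diag_le.
- exact: integral_Im_res_diag_le.
Qed.

Lemma cmeasurable_stieltjes : cmeasurable (fun w => stieltjes (hamiltonian T (V w)) z).
Proof.
apply: cmeasurableM; first exact: cmeasurable_cst.
by apply: cmeasurable_sum => i; exact: cmeasurable_resV.
Qed.

Lemma res_bound_ge0 (J : nat) : (0 <= 1 + 768 * c * J%:R :> R)%R.
Proof.
have h : (0 <= c * J%:R)%R by exact: (mulr_ge0 c0 (ler0n _ _)).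
lra.
Qed.

(** The weight [K] sees only the sites other than x, so averaging over V(x) comes first; the
    expectation of [K] is then found by averaging its term at u over V(u). *)
Lemma integral_Im_res_stieltjes_le x J : (1 <= 2 ^+ J * Im z)%R ->
  \int[P]_w (Im (G (V w) x x) * cabs (stieltjes (hamiltonian T (V w)) z))%:E <=
  (96 * c * (2 / (n%:R * Im z) + (1 + 768 * c * J%:R)))%:E.
Proof.
move=> J1; have M0 := res_bound_ge0 J.
have resM u (v : Omega -> 'I_n -> R) mv := @integral_cabs_res_le u v mv J J1.
move: (1 + 768 * c * J%:R)%R M0 resM => M M0 resM.
have n0 : (0 < n%:R :> R)%R by rewrite ltr0n (leq_ltn_trans _ (ltn_ord x)).
have nz0 : (0 <= 2 / (n%:R * Im z))%R by rewrite divr_ge0 // mulr_ge0 // ltW.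
pose g u (w : Omega) : R := cabs (G (upd (V w) x 0) u u).
have g0 u w : (0 <= g u w)%R by exact: cabs_ge0.
pose K (w : Omega) : R := (2 / (n%:R * Im z) + n%:R^-1 * \sum_(u | u != x) g u w)%R.
have K0 w : (0 <= K w)%R.
  by rewrite addr_ge0 // mulr_ge0 ?invr_ge0 ?(ltW n0) // sumr_ge0.
have mg u : measurable_fun [set: Om x] (g u : Om x -> R).
  apply: measurable_cabs; apply: cmeasurable_res => y.
  by apply: measurable_upd => [yx|]; [exact: measurable_other_site|exact: measurable_cst].
have mg' u : measurable_fun [set: Omega] (g u).
  by apply: measurable_fun_coarser (mg u); exact: other_sites_measurable.
have mK : measurable_fun [set: Om x] (K : Om x -> R).
  apply: measurable_funD => //; apply: measurable_funM => //.
  under eq_fun do rewrite -big_filter.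
  exact: measurable_sum.
have mK' : measurable_fun [set: Omega] K.
  by apply: measurable_fun_coarser mK; exact: other_sites_measurable.
apply: (@le_trans _ _ (\int[P]_w (K w * Im (G (upd (V w) x (V w x)) x x))%:E)).
  apply: ge0_le_integral => //.
  - by move=> w _; rewrite lee_fin mulr_ge0 ?cabs_ge0 ?Im_res_ge0.
  - apply/measurable_EFinP; apply: measurable_funM; first exact: measurable_Im_res.
    by apply: measurable_cabs; exact: cmeasurable_stieltjes.
  - apply/measurable_EFinP; apply: measurable_funM => //.
    by under eq_fun do rewrite upd_same; exact: measurable_Im_res.
  move=> w _; rewrite lee_fin upd_same mulrC ler_wpM2r ?Im_res_ge0 //.
  exact: cabs_stieltjes_le.
apply: (le_trans (integral_Im_res_le (@measurable_other_site x) K0 mK)).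
rewrite [leRHS]EFinM; apply: lee_wpmul2l; first by rewrite lee_fin mulr_ge0.
pose r := [seq u <- index_enum 'I_n | u != x].
have mS : measurable_fun [set: Omega] (fun w => \sum_(u <- r) (g u w)%:E).
  by apply: emeasurable_sum => u; exact/measurable_EFinP.
have S0 w : 0 <= \sum_(u <- r) (g u w)%:E by apply: sume_ge0 => u _; rewrite lee_fin.
have -> : \int[P]_w (K w)%:E =
    \int[P]_w ((2 / (n%:R * Im z))%:E + (n%:R^-1)%:E * \sum_(u <- r) (g u w)%:E).
  apply: eq_integral => w _; by rewrite sumEFin big_filter.
rewrite ge0_integralD //; last 2 first.
- by move=> w _; rewrite mule_ge0 // lee_fin invr_ge0 ltW.
- exact: measurable_funeM.
rewrite integral_cst_probability [leRHS]EFinD; apply: leeD2l.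
rewrite ge0_integralZl_EFin //.
rewrite ge0_integral_sum //; last 2 first.
- by move=> u; exact/measurable_EFinP.
- by move=> u w _; rewrite lee_fin.
(* The excluded index u = x is readmitted with the harmless bound 0 <= M, so that exactly n terms
   cancel the factor 1 / n. *)
apply: (@le_trans _ _ ((n%:R^-1)%:E * \sum_(u < n) M%:E)).
  apply: lee_wpmul2l; first by rewrite lee_fin invr_ge0 ltW.
  rewrite big_filter big_mkcond /=; apply: lee_sum => u _.
  case: ifPn => [ux|_]; last by rewrite lee_fin.
  have h := resM u (fun w => upd (V w) x 0).
  apply: le_trans (h _); last first.
    move=> y yu; apply: measurable_upd => [_|]; first exact: measurable_other_site.
    exact: measurable_cst.
  (* Since u differs from x, freezing x does not touch V(u), and writing V(u) back at u changes
     nothing. *)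
  rewrite le_eqVlt; apply/orP; left; apply/eqP; apply: eq_integral => w _.
  rewrite /g; congr ((cabs (G _ _ _))%:E).
  by rewrite -[LHS](upd_same _ u); congr (upd _ _ _); rewrite /upd (negPf ux).
rewrite sumEFin -EFinM lee_fin sumr_const card_ord -[(M *+ n)%R]mulr_natl mulKf //.
by rewrite gt_eqF.
Qed.

Lemma integral_stieltjes_res2_le x y J : (1 <= 2 ^+ J * Im z)%R ->
  \int[P]_w (cabs (stieltjes (hamiltonian T (V w)) z * (G (V w) *m G (V w)) y x))%:E <=
  (96 * c / Im z * (2 / (n%:R * Im z) + (1 + 768 * c * J%:R)))%:E.
Proof.
move=> J1; set B := (_ + (1 + _))%R.
have -> : (96 * c / Im z * B = (2 * Im z)^-1 * (96 * c * B + 96 * c * B))%R.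
  by field; rewrite gt_eqF.
pose s w := cabs (stieltjes (hamiltonian T (V w)) z).
have ms : measurable_fun setT s by apply: measurable_cabs; exact: cmeasurable_stieltjes.
apply: (integral_le_scaled_sum (A := fun w => (Im (G (V w) x x) * s w)%R)
                         (B := fun w => (Im (G (V w) y y) * s w)%R)).
- apply: measurable_cabs; apply: cmeasurableM; first exact: cmeasurable_stieltjes.
  by apply: cmeasurable_mulmx => k l; exact: cmeasurable_resV.
- by apply: measurable_funM => //; exact: measurable_Im_res.
- by apply: measurable_funM => //; exact: measurable_Im_res.
- by move=> w; exact: cabs_ge0.
- by move=> w; rewrite mulr_ge0 ?cabs_ge0 ?Im_res_ge0.
- by move=> w; rewrite mulr_ge0 ?cabs_ge0 ?Im_res_ge0.
- by rewrite invr_ge0 mulr_ge0 // ltW.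
- move=> w; rewrite cabsM -mulrDl mulrA [leLHS]mulrC ler_wpM2r ?cabs_ge0 // [leRHS]mulrC.
  by apply: resolvent2_le => //; exact: hermitian_hamiltonian.
- exact: integral_Im_res_stieltjes_le.
- exact: integral_Im_res_stieltjes_le.
Qed.
End fixed_kinetic_term.

(** * Random kinetic term *)

Section independence.
Local Open Scope ereal_scope.
Context (R : realType) (d : measure_display) (Omega : measurableType d).
Variables (P : probability Omega R) (G1 G2 : set (set Omega)).
Hypotheses (mG1 : G1 `<=` d.-measurable) (mG2 : G2 `<=` d.-measurable).
Hypothesis indep : forall A B, <<s G1 >> A -> <<s G2 >> B -> P (A `&` B) = P A * P B.
Local Notation Om1 := (g_sigma_algebraType G1).
Local Notation Om2 := (g_sigma_algebraType G2).

(* The diagonal map sends P to the product of its restrictions to the two sigma-algebras. *)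
Lemma integral_indep_le (h : Om1 * Om2 -> \bar R) (M : R) :
  measurable_fun setT h -> (forall w, 0 <= h w) ->
  (forall w1 : Om1, \int[P]_w h (w1, w) <= M%:E) ->
  \int[P]_w h (w, w) <= M%:E.
Proof.
move=> mh h0 hM.
have m1 := measurable_idfun_coarser mG1; have m2 := measurable_idfun_coarser mG2.
pose i1 := isMeasurableFun.Build _ _ _ _ _ m1.
pose i2 := isMeasurableFun.Build _ _ _ _ _ m2.
pose f1 : {mfun Omega >-> Om1} := HB.pack (idfun : Omega -> Om1) i1.
pose f2 : {mfun Omega >-> Om2} := HB.pack (idfun : Omega -> Om2) i2.
pose P1 := distribution P f1; pose P2 := distribution P f2.
have mdiag : measurable_fun setT ((fun w => (w, w)) : Omega -> Om1 * Om2).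
  exact: measurable_fun_pair.
pose m' := image_measure P mdiag.
have m'E : forall X, measurable X -> (P1 \x P2) X = m' X.
  by apply: product_measure_unique => A B mA mB; exact: indep.
have -> : \int[P]_w h (w, w) = \int[m']_w h w.
  by rewrite ge0_integral_pushforward.
have -> : \int[m']_w h w = \int[P1 \x P2]_w h w.
  by apply: eq_measure_integral => A mA _; rewrite -m'E.
(* The inner integral, with the first coordinate fixed, is the one that [hM] bounds. *)
rewrite fubini_tonelli1 //.
apply: (@le_trans _ _ (\int[P1]_w M%:E)).
  apply: ge0_le_integral => //.
  - by move=> w _; apply: integral_ge0.
  - exact: measurable_fun_fubini_tonelli_F.
  move=> w _; rewrite /fubini_F ge0_integral_pushforward //; last exact: measurable_fun_pair2.
  exact: hM.
by rewrite (integral_cst_probability P1).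
Qed.
End independence.

(** * Number of dyadic scales and the final comparison *)

(** For the least J, if positive, 2^(J - 1) eta < 1, so (J - 1) ln 2 <= - ln eta = ln n + ln (1 / (n
    eta)); then ln t < t, and ln 2 >= 1/2 gives the factor 2. *)
Lemma dyadic_scale (R : realType) (n : nat) (eta : R) : (0 < n)%N -> 0 < eta ->
  exists J : nat, 1 <= 2 ^+ J * eta /\
    J%:R <= 1 + 2 * (ln n%:R + (n%:R * eta)^-1).
Proof.
move=> n0 e0; have n1 : 1 <= n%:R :> R by rewrite ler1n.
have nr0 : 0 < n%:R :> R by rewrite ltr0n.
have L0 : 0 <= ln n%:R :> R by exact: ln_ge0.
have i0 : 0 < (n%:R * eta)^-1 by rewrite invr_gt0 mulr_gt0.
have exJ : exists J : nat, 1 <= 2 ^+ J * eta.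
  exists (Num.trunc eta^-1).+1; rewrite -ler_pdivrMr // div1r.
  have ei0 : 0 <= eta^-1 by rewrite invr_ge0 ltW.
  have /andP[_ /ltW h] := truncn_itv ei0.
  by apply: le_trans h _; rewrite -natrX ler_nat ltnW // ltn_expl.
case: (ex_minnP exJ) => -[|k] h1 hmin; [exists 0%N|exists k.+1]; split => //.
  rewrite addr_ge0 // mulr_ge0 // addr_ge0 // ltW //.
have hk : 2 ^+ k * eta < 1.
  by rewrite ltNge; apply/negP => /hmin; rewrite ltnn.
(* From ln (1 + t) <= t at t = -1/2. *)
have ln2 : 2^-1 <= ln 2 :> R.
  have h2 : -1 < - 2^-1 :> R by lra.
  have := le_ln1Dx h2.
  have -> : 1 + - 2^-1 = 2^-1 :> R by field.
  by rewrite lnV ?posrE // lerN2.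
have lk : k%:R * ln 2 + ln eta <= 0.
  rewrite mulr_natl -lnXn // -lnM ?posrE ?exprn_gt0 //; exact/ln_le0/ltW.
have le : - ln eta <= ln n%:R + (n%:R * eta)^-1.
  rewrite -lnV ?posrE //.
  have -> : eta^-1 = n%:R * (n%:R * eta)^-1 by field; rewrite !gt_eqF.
  by rewrite lnM ?posrE // lerD2l ltW // ln_sublinear.
have kl : k%:R * 2^-1 <= k%:R * ln 2 :> R by exact: ler_wpM2l.
rewrite -[k.+1%:R]natr1; lra.
Qed.

(** Read B = 96 C_V, L = ln n and e = 1 / (n Im z), so that n e = 1 / Im z. The products e^2 and L e
    are absorbed through e <= 1 + e^2, the source of the factor 1 + e^2. *)
Lemma dyadic_log_bound_le (R : realType) (B n L e J : R) : 0 <= B -> 0 <= n -> 0 <= L -> 0 <= e ->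
  J <= 1 + 2 * (L + e) ->
  B * (n * e) * (2 * e + (1 + 8 * B * J)) <=
  B * (2 + 16 * B) * n * (L + e) * (1 + e ^+ 2) + B * (2 + 16 * B) * (n * e).
Proof.
move=> B0 n0 L0 e0 hJ.
have BJ : B * e * J <= B * e * (1 + 2 * (L + e)) by apply: ler_wpM2l => //; exact: mulr_ge0.
have p1 : 0 <= e - e ^+ 2 + e ^+ 3.
  have -> : e - e ^+ 2 + e ^+ 3 = e * ((e - 2^-1) ^+ 2 + 3 / 4) by field.
  by apply: mulr_ge0 => //; have := sqr_ge0 (e - 2^-1); lra.
have p2 : 0 <= L - L * e + L * e ^+ 2.
  have -> : L - L * e + L * e ^+ 2 = L * ((e - 2^-1) ^+ 2 + 3 / 4) by field.
  by apply: mulr_ge0 => //; have := sqr_ge0 (e - 2^-1); lra.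
have Bp1 := mulr_ge0 B0 p1.
have Bp2 := mulr_ge0 B0 p2.
have Be := mulr_ge0 B0 e0.
have Le2 : 0 <= L * e ^+ 2 by apply: mulr_ge0 => //; exact: sqr_ge0.
have key : e * (2 * e + (1 + 8 * B * J)) <= (2 + 16 * B) * ((L + e) * (1 + e ^+ 2) + e).
  lra.
have := ler_wpM2l (mulr_ge0 B0 n0) key.
lra.
Qed.

Theorem theorem3p2 (R : realType) (CV : R) :
  exists C : R,
  forall (N : nat) (d : measure_display) (Omega : measurableType d)
    (P : probability Omega R)
    (T : Omega -> 'M[R[i]]_N) (V : Omega -> 'I_N -> R),
    (* T is a Hermitian random matrix *)
    (forall w, hermitian_mx (T w)) ->
    (forall ijb, measurable_fun setT (entry_rv T ijb)) ->
    (* V is a random potential *)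
    (forall x, measurable_fun setT (fun w => V w x)) ->
    (* T is independent of V *)
    (forall A B,
        gen_sigma (fun _ => True) (entry_rv T) A ->
        gen_sigma (fun _ => True) (fun x w => V w x) B ->
        P (A `&` B) = (P A * P B)%E) ->
    (* P(V(x) in I | {V(y)}_{y <> x}) <= CV |I| for all Borel I and all x *)
    (forall (x : 'I_N) (I : set R) (A : set Omega),
        measurable I ->
        gen_sigma (fun y => y != x) (fun y w => V w y) A ->
        (P ((fun w => V w x) @^-1` I `&` A) <= CV%:E * lebesgue_measure I * P A)%E) ->
    forall (x y : 'I_N) (z : R[i]), 0 < complex.Im z ->
      (\int[P]_w (cabs ((2 * N%:R)^-1 *
            cderiv (cderiv (green (hamiltonian (T w) (V w)) x y)) z))%:E
         <= (C / (N%:R * complex.Im z ^+ 2))%:E)%E /\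
      (\int[P]_w (cabs (stieltjes (hamiltonian (T w) (V w)) z *
            cderiv (green (hamiltonian (T w) (V w)) x y) z))%:E
         <= (C * N%:R * (ln N%:R + (N%:R * complex.Im z)^-1)
               * (1 + ((N%:R * complex.Im z) ^+ 2)^-1) + C / complex.Im z)%:E)%E.
Proof.
(* With B = 96 C_V, the factor B comes from averaging Im R(x,x), and 2 + 16 B from the bound on
   S(z). *)
exists (96 * CV * (2 + 16 * (96 * CV))).
move=> N d Omega P T V TH mT mV indep PV x y z z0.
have N0 : (0 < N)%N by exact: leq_ltn_trans (ltn_ord x).
have n0 : 0 < N%:R :> R by rewrite ltr0n.
(* The density bound for I = [0, 1] and the full event; it needs a site x to exist. *)
have c0 : 0 <= CV.
  have m01 : measurable (`[0, 1]%classic : set R) by exact: measurable_itv.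
  have h := PV x _ setT m01 (@measurableT _ (g_sigma_algebraType _)).
  have := le_trans (measure_ge0 P _) h.
  rewrite probability_setT mule1 lebesgue_measure_itv /= lte_fin ltr01.
  by rewrite -EFinB subr0 mule1 lee_fin.
pose G1 := [set A | exists i (B : set R), [/\ True, measurable B & A = entry_rv T i @^-1` B]].
pose G2 := [set A | exists i (B : set R), [/\ True, measurable B & A = (fun w => V w i) @^-1` B]].
have mG1 : G1 `<=` d.-measurable.
  by move=> _ [i [B [_ mB ->]]]; rewrite -[X in measurable X]setTI; exact: mT.
have mG2 : G2 `<=` d.-measurable.
  by move=> _ [i [B [_ mB ->]]]; rewrite -[X in measurable X]setTI; exact: mV.
pose Om12 := (g_sigma_algebraType G1 * g_sigma_algebraType G2)%type.
(* T and V are read at separate sample points, which makes the integrand a function on the product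
   space required by [integral_indep_le]. *)
have mres i j : cmeasurable (fun w : Om12 => res (T w.1) z (V w.2) i j).
  apply: cmeasurable_resolvent => // [w|k l]; first exact: hermitian_hamiltonian.
  under eq_fun do rewrite !mxE; apply: cmeasurableD.
    have mE b : measurable_fun setT (fun w : Om12 => entry_rv T (k, l, b) w.1).
      apply: (@measurableT_comp _ _ _ _ _ _ (entry_rv T (k, l, b) : g_sigma_algebraType G1 -> R)) => //.
      by move=> _ B mB; rewrite setTI; apply: sub_sigma_algebra; exists (k, l, b), B.
    split; [exact: (mE true)|exact: (mE false)].
  case: (k == l); last by under eq_fun do rewrite mulr0n; exact: cmeasurable_cst.
  under eq_fun do rewrite mulr1n.
  split; last exact: measurable_cst.
  apply: (@measurableT_comp _ _ _ _ _ _ ((fun w => V w k) : g_sigma_algebraType G2 -> R)) => //.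
  by move=> _ B mB; rewrite setTI; apply: sub_sigma_algebra; exists k, B.
have HH w : hermitian_mx (hamiltonian (T w) (V w)) by exact: hermitian_hamiltonian.
split.
  (* Replacing derivatives by resolvent products makes measurability an algebraic matter. *)
  under eq_integral do rewrite (cderiv2_green (HH _)) //.
  have h := @integral_indep_le R d Omega P G1 G2 mG1 mG2 indep
    (fun w => (cabs ((2 * N%:R)^-1 * (2 * (res (T w.1) z (V w.2) *m res (T w.1) z (V w.2) *m res (T w.1) z (V w.2)) y x)))%:E)
    (96 * CV / (N%:R * complex.Im z ^+ 2)).
  apply: (le_trans (h _ _ _)).
  - apply/measurable_EFinP; apply: measurable_cabs; apply: cmeasurableM; first exact: cmeasurable_cst.
    apply: cmeasurableM; first exact: cmeasurable_cst.
    by apply: cmeasurable_mulmx => // i j; exact: cmeasurable_mulmx.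
  - by move=> w; rewrite lee_fin cabs_ge0.
  - by move=> w; exact: (integral_res3_le (TH w) z0 c0 mV PV).
  rewrite lee_fin ler_pM2r ?invr_gt0 ?mulr_gt0 ?exprn_gt0 //.
  have := sqr_ge0 CV; nra.
have [J [J1 J2]] := dyadic_scale N0 z0.
under eq_integral do rewrite (cderiv_green (HH _)) //.
have h := @integral_indep_le R d Omega P G1 G2 mG1 mG2 indep
  (fun w => (cabs (stieltjes (hamiltonian (T w.1) (V w.2)) z * (res (T w.1) z (V w.2) *m res (T w.1) z (V w.2)) y x))%:E)
  (96 * CV / complex.Im z * (2 / (N%:R * complex.Im z) + (1 + 768 * CV * J%:R))).
apply: (le_trans (h _ _ _)).
- apply/measurable_EFinP; apply: measurable_cabs; apply: cmeasurableM; last exact: cmeasurable_mulmx.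
  apply: cmeasurableM; first exact: cmeasurable_cst.
  by apply: cmeasurable_sum => i; exact: mres.
- by move=> w; rewrite lee_fin cabs_ge0.
- by move=> w; exact: (integral_stieltjes_res2_le (TH w) z0 c0 mV PV x y J1).
rewrite lee_fin.
have L0 : 0 <= ln N%:R :> R by apply: ln_ge0; rewrite ler1n.
have e0 : 0 < (N%:R * complex.Im z)^-1 by rewrite invr_gt0 mulr_gt0.
have -> : (complex.Im z)^-1 = N%:R * (N%:R * complex.Im z)^-1 by field; rewrite !gt_eqF.
rewrite -exprVn.
move: (ln N%:R) (N%:R * complex.Im z)^-1 L0 e0 J2 => L e L0 e0 J2.
(* Brings the bound to the form with B = 96 C_V. *)
rewrite [768 * CV](_ : _ = 8 * (96 * CV)); last by ring.
by apply: dyadic_log_bound_le => //; [exact: (mulr_ge0 (ler0n _ _) c0)|exact: ltW].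
Qed.
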